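(* Let $\alpha\in\mathbb{R}$, and let $L$ be slowly varying at the origin (resp. at infinity). If $\mathbf{f}\in\mathcal{S}'(\mathbb{R}^{n},E)$ has quasiasymptotic behavior of degree $\alpha$ at the origin (resp. at infinity) with respect to $L$ in the space $\mathcal{D}'(\mathbb{R}^{n},E)$, then $\mathbf{f}$ has the same quasiasymptotic behavior in the space $\mathcal{S}'(\mathbb{R}^{n},E)$.
   Context: $E$ is a Banach space with norm $\|\cdot\|$. For $\mathcal{A}=\mathcal{D}$ or $\mathcal{S}$, $\mathcal{A}'(\mathbb{R}^{n},E)$ is the space of continuous linear mappings $\mathcal{A}(\mathbb{R}^{n})\to E$. A positive measurable function $L$ on an interval $(0,A)$ (resp. $(A,\infty)$) is slowly varying at the origin (resp. at infinity) if $\lim_{\lambda\to0^{+}}L(a\lambda)/L(\lambda)=1$ (resp. $\lim_{\lambda\to\infty}$) for each $a>0$. $\mathbf{f}$ has quasiasymptotic behavior of degree $\alpha$ at the origin (resp. at infinity) with respect to $L$ in $\mathcal{A}'(\mathbb{R}^{n},E)$ if there exists $\mathbf{g}\in\mathcal{A}'(\mathbb{R}^{n},E)$ such that for each $\phi\in\mathcal{A}(\mathbb{R}^{n})$, $\frac{1}{\lambda^{\alpha}L(\lambda)}\langle\mathbf{f}(\lambda t),\phi(t)\rangle\to\langle\mathbf{g}(t),\phi(t)\rangle$ in the norm of $E$ as $\lambda\to0^{+}$ (resp. $\lambda\to\infty$), where $\langle\mathbf{f}(\lambda t),\phi(t)\rangle=\lambda^{-n}\langle\mathbf{f}(t),\phi(t/\lambda)\rangle$.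 ''The same'' quasiasymptotic behavior in $\mathcal{S}'$ means: the limit distribution $\mathbf{g}\in\mathcal{D}'(\mathbb{R}^n,E)$ extends to an element of $\mathcal{S}'(\mathbb{R}^{n},E)$ and the limit relation holds, with the same $\alpha$ and $L$, for all $\phi\in\mathcal{S}(\mathbb{R}^{n})$. *)

(* Defs.v *)
From HB Require Import structures.
From mathcomp Require Import all_boot all_order all_algebra.
From mathcomp Require Import complex.
From mathcomp Require Import all_classical all_reals all_analysis.
From mathcomp Require Import measurable_realfun.

Set Implicit Arguments.
Unset Strict Implicit.
Unset Printing Implicit Defensive.

Import Order.TTheory GRing.Theory Num.Theory.
Import numFieldNormedType.Exports.

Local Open Scope classical_set_scope.
Local Open Scope ring_scope.
Local Open Scope complex_scope.

Section smooth.
Context {R : realType} {n : nat}.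
Implicit Types phi : 'rV[R]_n -> R[i].

(* The derivative of a complex-valued function of a real variable is taken
   componentwise, since [R[i]] is not a normed module over [R] here. *)
Definition partial (i : 'I_n) phi : 'rV[R]_n -> R[i] := fun x =>
  'D_(delta_mx 0 i) (fun y => complex.Re (phi y)) x
  +i* 'D_(delta_mx 0 i) (fun y => complex.Im (phi y)) x.

(* Iterated partial derivatives are indexed by the sequence of directions, not
   by a multi-index: [partials [:: i; j] phi] is [partial i (partial j phi)].
   On smooth functions the order is irrelevant. *)
Definition partials (s : seq 'I_n) phi : 'rV[R]_n -> R[i] :=
  foldr partial phi s.

Definition smooth phi := forall s : seq 'I_n,
  continuous (partials s phi : 'rV[R]_n -> R[i]^o) /\
  forall i x,
    derivable (fun y => complex.Re (partials s phi y)) x (delta_mx 0 i) /\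
    derivable (fun y => complex.Im (partials s phi y)) x (delta_mx 0 i).

Definition monomial (b : {ffun 'I_n -> nat}) (x : 'rV[R]_n) : R :=
  \prod_i x 0 i ^+ b i.

Definition weighted_partials (bs : {ffun 'I_n -> nat} * seq 'I_n) phi :
    'rV[R]_n -> R[i] :=
  fun x => (monomial bs.1 x)%:C * partials bs.2 phi x.

Definition rapidly_decreasing phi := forall bs,
  exists M : R, forall x, `|weighted_partials bs phi x| <= M%:C.

Definition supp phi := closure [set x | phi x != 0].

Definition schwartz_pred : {pred 'rV[R]_n -> R[i]} :=
  fun phi => `[< smooth phi /\ rapidly_decreasing phi >].

Definition testfun_pred : {pred 'rV[R]_n -> R[i]} :=
  fun phi => `[< smooth phi /\ compact (supp phi) >].

Lemma partial_lin i (a : R[i]) (u v : 'rV[R]_n -> R[i]) :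
  (forall x, derivable (fun y => complex.Re (u y)) x (delta_mx 0 i) /\
    derivable (fun y => complex.Im (u y)) x (delta_mx 0 i)) ->
  (forall x, derivable (fun y => complex.Re (v y)) x (delta_mx 0 i) /\
    derivable (fun y => complex.Im (v y)) x (delta_mx 0 i)) ->
  (forall x,
    derivable (fun y => complex.Re ((a *: u + v) y)) x (delta_mx 0 i) /\
    derivable (fun y => complex.Im ((a *: u + v) y)) x (delta_mx 0 i)) /\
  partial i (a *: u + v) = a *: partial i u + partial i v.
Proof.
move=> du dv.
have ReE : (fun y => complex.Re ((a *: u + v) y)) =
    complex.Re a *: (fun y => complex.Re (u y))
    - complex.Im a *: (fun y => complex.Im (u y))
    + (fun y => complex.Re (v y)).
  apply/funext => y; rewrite !fctE.
  by case: (a) (u y) (v y) => [a1 a2] [u1 u2] [v1 v2].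
have ImE : (fun y => complex.Im ((a *: u + v) y)) =
    complex.Re a *: (fun y => complex.Im (u y))
    + complex.Im a *: (fun y => complex.Re (u y))
    + (fun y => complex.Im (v y)).
  apply/funext => y; rewrite !fctE.
  by case: (a) (u y) (v y) => [a1 a2] [u1 u2] [v1 v2].
have dRe1 x : derivable (complex.Re a *: (fun y => complex.Re (u y))
    - complex.Im a *: (fun y => complex.Im (u y))) x (delta_mx 0 i).
  by apply: derivableB; apply: derivableZ; case: (du x).
have dIm1 x : derivable (complex.Re a *: (fun y => complex.Im (u y))
    + complex.Im a *: (fun y => complex.Re (u y))) x (delta_mx 0 i).
  by apply: derivableD; apply: derivableZ; case: (du x).
split.
  move=> x; rewrite ReE ImE; have [? ?] := dv x.
  by split; apply: derivableD.
apply/funext => x; rewrite {1}/partial ReE ImE.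
have [u1 u2] := du x; have [v1 v2] := dv x.
rewrite (deriveD (dRe1 x) v1) (deriveD (dIm1 x) v2).
rewrite deriveB; [|exact: derivableZ..].
rewrite deriveD; [|exact: derivableZ..].
by rewrite !deriveZ // !fctE /partial; case: (a).
Qed.

Lemma partials_lin (a : R[i]) (u v : 'rV[R]_n -> R[i]) s :
  smooth u -> smooth v ->
  partials s (a *: u + v) = a *: partials s u + partials s v.
Proof.
move=> su sv; elim: s => //= i s ->.
exact: (partial_lin a (fun x => (su s).2 i x) (fun x => (sv s).2 i x)).2.
Qed.

Lemma continuous_lin (T : topologicalType) (a : R[i]) (u v : T -> R[i]^o) :
  continuous u -> continuous v -> continuous (fun x => a *: u x + v x).
Proof.
move=> cu cv x; apply: (@cvgD _ R[i]^o); last exact: cv.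
by apply: (@cvgZl_tmp _ R[i]^o); exact: cu.
Qed.

Lemma smooth_lin (a : R[i]) (u v : 'rV[R]_n -> R[i]) :
  smooth u -> smooth v -> smooth (a *: u + v).
Proof.
move=> su sv s; rewrite partials_lin//; split.
  exact: (continuous_lin (su s).1 (sv s).1).
move=> i.
exact: (partial_lin a (fun x => (su s).2 i x) (fun x => (sv s).2 i x)).1.
Qed.

Lemma rapidly_decreasing_lin (a : R[i]) (u v : 'rV[R]_n -> R[i]) :
  smooth u -> smooth v -> rapidly_decreasing u -> rapidly_decreasing v ->
  rapidly_decreasing (a *: u + v).
Proof.
move=> su sv du dv bs; have [M1 uM1] := du bs; have [M2 vM2] := dv bs.
exists (complex.Re `|a| * M1 + M2) => x.
rewrite /weighted_partials partials_lin// !fctE mulrDr.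
rewrite (le_trans (ler_normD _ _))// rmorphD lerD//; last exact: vM2.
have -> : a *: partials bs.2 u x = a * partials bs.2 u x by [].
rewrite mulrCA normrM rmorphM.
exact: (ler_wpM2l (normr_ge0 a) (uM1 x)).
Qed.

Lemma partials0 s : partials s (0 : 'rV[R]_n -> R[i]) = 0.
Proof.
elim: s => //= i s ->; apply/funext => x.
by rewrite /partial (derive_cst (0 : R)).
Qed.

Lemma smooth0 : smooth (0 : 'rV[R]_n -> R[i]).
Proof.
move=> s; rewrite partials0; split; first by apply: (@cst_continuous _ R[i]^o 0).
by move=> i x; split; apply: (derivable_cst (0 : R)).
Qed.

Lemma schwartz_submod_closed : submod_closed schwartz_pred.
Proof.
split.
  apply/asboolP; split; [exact: smooth0|move=> bs; exists 0 => x].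
  by rewrite /weighted_partials partials0 mulr0 normr0.
move=> a u v /asboolP[su du] /asboolP[sv dv]; apply/asboolP.
by split; [exact: smooth_lin|exact: rapidly_decreasing_lin].
Qed.

Lemma testfun_submod_closed : submod_closed testfun_pred.
Proof.
split.
  apply/asboolP; split; first exact: smooth0.
  rewrite /supp (_ : [set x | _] = set0); first by rewrite closure0; exact: compact0.
  by rewrite -subset0 => x /=; rewrite eqxx.
move=> a u v /asboolP[su cu] /asboolP[sv cv]; apply/asboolP.
split; first exact: smooth_lin.
apply: (subclosed_compact _ (compactU cu cv)); first exact: closed_closure.
rewrite -closureU; apply: closureS => x /=.
rewrite !fctE; have [->|u0 _] := eqVneq (u x) 0; last by left.
by rewrite scaler0 add0r; right.
Qed.

Lemma partials_supp s phi x : ~ supp phi x -> partials s phi x = 0.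
Proof.
elim: s x => [x|i s IH x] nx /=.
  by apply: contrapT => /eqP p0; apply/nx/subset_closure.
have U : \forall y \near x, ~ supp phi y.
  apply: (@open_nbhs_nbhs _ _ (~` supp phi)); split=> //.
  by apply: closed_openC; exact: closed_closure.
rewrite /partial (@near_eq_derive _ _ _ _ (cst 0)); last first.
  by near=> y; rewrite IH//; near: y.
rewrite (@near_eq_derive _ _ _ (fun y => complex.Im _) (cst 0)); last first.
  by near=> y; rewrite IH//; near: y.
by rewrite !derive_cst.
Unshelve. all: by end_near. Qed.

Lemma normc_le_ReIm (z : R[i]) :
  `|z| <= (`|complex.Re z| + `|complex.Im z|)%:C.
Proof.
rewrite {1}(complexE z) (le_trans (ler_normD _ _))// rmorphD/=.
rewrite normrM lerD//.
  by rewrite normc_def /= expr0n addr0 sqrtr_sqr.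
rewrite !normc_def /= !expr0n expr1n add0r addr0 sqrtr1 mul1r.
by rewrite sqrtr_sqr.
Qed.

Lemma Re_continuous : continuous (@complex.Re R : R[i]^o -> R).
Proof.
move=> z A /nbhs_ballP[e /= e0 eA].
apply: (@filterS _ (nbhs (z : R[i]^o)) _ (ball (z : R[i]^o) e%:C)).
  move=> w; rewrite -ball_normE/= => zw.
  apply: eA; rewrite -ball_normE/= -ltcR; apply: le_lt_trans zw.
  rewrite (_ : complex.Re z - _ = complex.Re ((z : R[i]) - w)); last by case: (z) (w) => ? ? [].
  exact: normc_ge_Re.
by apply: nbhsx_ballx; rewrite ltcR.
Qed.

Lemma Im_continuous : continuous (@complex.Im R : R[i]^o -> R).
Proof.
move=> z A /nbhs_ballP[e /= e0 eA].
apply: (@filterS _ (nbhs (z : R[i]^o)) _ (ball (z : R[i]^o) e%:C)).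
  move=> w; rewrite -ball_normE/= => zw.
  apply: eA; rewrite -ball_normE/= -ltcR; apply: le_lt_trans zw.
  rewrite (_ : complex.Im z - _ = complex.Im ((z : R[i]) - w)); last by case: (z) (w) => ? ? [].
  rewrite -[complex.Im _]opprK -ReiNIm normrN.
  rewrite (le_trans (normc_ge_Re _))// normrM.
  by rewrite [X in _ * X]normc_def/= expr0n expr1n add0r sqrtr1 mulr1.
by apply: nbhsx_ballx; rewrite ltcR.
Qed.

Lemma monomial_continuous b : continuous (monomial b).
Proof.
apply: (@continuous_big R 'I_n *%R 1 xpredT _ 'rV[R]_n _
  (fun i x => x 0 i ^+ b i)); first exact: mul_continuous.
move=> i _ x; apply: (@continuous_comp 'rV[R]_n R R (fun x => x 0 i) (fun y => y ^+ b i)).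
  exact: coord_continuous.
exact: exprn_continuous.
Qed.

Lemma testfun_pred_schwartz phi :
  phi \in testfun_pred -> phi \in schwartz_pred.
Proof.
move=> /asboolP[sphi cphi]; apply/asboolP; split=> // bs.
have bnd (c : R[i] -> R) : continuous (c : R[i]^o -> R) ->
    exists M, forall x, supp phi x ->
      `|monomial bs.1 x * c (partials bs.2 phi x)| <= M.
  move=> cc.
  have cm : continuous (fun x => monomial bs.1 x * c (partials bs.2 phi x)).
    move=> x; apply: (@continuousM R 'rV[R]_n (monomial bs.1)
      (fun x => c (partials bs.2 phi x))); first exact: monomial_continuous.
    exact: (@continuous_comp 'rV[R]_n R[i]^o R _ c x ((sphi bs.2).1 x) (cc _)).
  have : bounded_set
      ((fun x => monomial bs.1 x * c (partials bs.2 phi x)) @` supp phi).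
    apply: compact_bounded; apply: continuous_compact => //.
    exact: continuous_subspaceT.
  move=> [M [_ hM]]; exists (M + 1) => x sx.
  by apply: (hM (M + 1)); [rewrite ltrDl|exists x].
have [M1 hM1] := bnd _ Re_continuous; have [M2 hM2] := bnd _ Im_continuous.
exists (Num.max 0 (M1 + M2)) => x.
have [sx|nsx] := pselect (supp phi x); last first.
  by rewrite /weighted_partials partials_supp// mulr0 normr0 lecR le_max lexx.
rewrite (le_trans (normc_le_ReIm _))// lecR le_max; apply/orP; right.
rewrite /weighted_partials; move: (hM1 x sx) (hM2 x sx).
case: (partials _ _ _) => p q /= h1 h2.
by rewrite !mul0r subr0 addr0 lerD.
Qed.

Definition dilate_fun (l : R) phi : 'rV[R]_n -> R[i] :=
  fun t => phi (l^-1 *: t).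

Lemma scale_dnbhs0 (c : R) : c != 0 -> (c * h) @[h --> 0^'] --> 0^'.
Proof.
move=> c0 A [e /= e0 eA]; exists (e / `|c|) => /=.
  by rewrite divr_gt0 ?normr_gt0.
move=> h; rewrite /= sub0r normrN => he h0; apply: eA => /=.
  by rewrite sub0r normrN normrM mulrC -ltr_pdivlMr ?normr_gt0.
exact: mulf_neq0.
Qed.

Lemma derive_scale (f : 'rV[R]_n -> R) (c : R) (x v : 'rV[R]_n) :
  c != 0 -> derivable f (c *: x) v ->
  derivable (fun y => f (c *: y)) x v /\
  'D_v (fun y => f (c *: y)) x = c * 'D_v f (c *: x).
Proof.
move=> c0 df.
have cvg_c : (fun h => h^-1 *:
      (((fun y => f (c *: y)) \o shift x) (h *: v) - f (c *: x))) @ 0^' -->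
    c * 'D_v f (c *: x).
  rewrite (_ : (fun h => _) = (fun h => c * ((c * h)^-1 *:
      ((f \o shift (c *: x)) ((c * h) *: v) - f (c *: x))))); last first.
    apply/funext => h /=; rewrite [c *: (_ + _)]scalerDr scalerA invfM.
    set d := f _ - f _; change (h^-1 * d = c * (c^-1 * h^-1 * d)).
    by rewrite !mulrA divff// mul1r.
  apply: (@cvgM R R _ _ (cst c)); first exact: cvg_cst.
  exact: (cvg_comp _ _ (scale_dnbhs0 c0) df).
split; first by apply/cvg_ex; exists (c * 'D_v f (c *: x)).
exact: cvg_lim cvg_c.
Qed.

Lemma realM_complex (r a b : R) : r%:C * (a +i* b) = (r * a) +i* (r * b).
Proof. by apply/eqP; rewrite eq_complex /= !mul0r subr0 addr0 !eqxx. Qed.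

Lemma Re_realM (T : Type) (r : R) (f : T -> R[i]) :
  (fun y => complex.Re (r%:C * f y)) = r *: (fun y => complex.Re (f y)).
Proof. by apply/funext => y; rewrite fctE; case: (f y) => a b; rewrite realM_complex. Qed.

Lemma Im_realM (T : Type) (r : R) (f : T -> R[i]) :
  (fun y => complex.Im (r%:C * f y)) = r *: (fun y => complex.Im (f y)).
Proof. by apply/funext => y; rewrite fctE; case: (f y) => a b; rewrite realM_complex. Qed.

Lemma partials_dilate l phi s : l != 0 -> smooth phi ->
  partials s (dilate_fun l phi) =
  fun x => (l ^- size s)%:C * partials s phi (l^-1 *: x).
Proof.
move=> l0 sphi; have l0' : l^-1 != 0 by rewrite invr_eq0.
elim: s => [|i s IH]; first by apply/funext => x /=; rewrite invr1 mul1r.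
apply/funext => x; rewrite [LHS]/= IH [partials _ phi]/= /partial.
have [d1 d2] := (sphi s).2 i (l^-1 *: x).
have [e1 E1] := derive_scale l0' d1; have [e2 E2] := derive_scale l0' d2.
pose k := l ^- size s.
rewrite (Re_realM k) (Im_realM k).
rewrite (deriveZ _ e1) (deriveZ _ e2) E1 E2 realM_complex.
have kE r : k *: (l^-1 * r) = l ^- size (i :: s) * r :> R.
  by change (k * (l^-1 * r) = l ^- (size s).+1 * r); rewrite /k exprS invfM mulrCA mulrA.
by rewrite !kE.
Qed.

Lemma continuous_scale (T : topologicalType) (a : R[i]) (u : T -> R[i]^o) :
  continuous u -> continuous (fun x => a *: u x).
Proof. by move=> cu x; apply: (@cvgZl_tmp _ R[i]^o); exact: cu. Qed.

Lemma continuous_realM_scale (f : 'rV[R]_n -> R[i]^o) (r c : R) :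
  continuous f ->
  continuous ((fun x => r%:C * f (c *: x)) : 'rV[R]_n -> R[i]^o).
Proof.
move=> cf; apply: (@continuous_scale 'rV[R]_n r%:C (fun x => f (c *: x))).
move=> x; apply: (@continuous_comp 'rV[R]_n 'rV[R]_n R[i]^o (fun x => c *: x) f).
  exact: scaler_continuous.
exact: cf.
Qed.

Lemma smooth_dilate l phi : l != 0 -> smooth phi -> smooth (dilate_fun l phi).
Proof.
move=> l0 sphi s; have l0' : l^-1 != 0 by rewrite invr_eq0.
rewrite partials_dilate//; split.
  exact: (continuous_realM_scale (sphi s).1).
move=> i x; rewrite Re_realM Im_realM.
have [d1 d2] := (sphi s).2 i (l^-1 *: x).
by split; apply: derivableZ;
  [exact: (derive_scale l0' d1).1|exact: (derive_scale l0' d2).1].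
Qed.

Lemma monomialZ b (l : R) x :
  monomial b (l *: x) = l ^+ (\sum_i b i) * monomial b x.
Proof.
rewrite /monomial -prodrXr -big_split/=; apply: eq_bigr => i _.
by rewrite mxE exprMn.
Qed.

Lemma dilate_schwartz l phi :
  l != 0 -> phi \in schwartz_pred -> dilate_fun l phi \in schwartz_pred.
Proof.
move=> l0 /asboolP[sphi dphi]; apply/asboolP; split; first exact: smooth_dilate.
move=> bs; have [M hM] := dphi bs.
pose k : R := l ^+ (\sum_i bs.1 i) * l ^- size bs.2.
exists (`|k| * M) => x; rewrite /weighted_partials partials_dilate//.
have -> : monomial bs.1 x =
    l ^+ (\sum_i bs.1 i) * monomial bs.1 (l^-1 *: x).
  by rewrite -monomialZ scalerA divff// scale1r.
rewrite [X in X%:C * _]mulrC rmorphM -mulrA [X in _ * X]mulrA -rmorphM -/k.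
rewrite [leLHS](_ : _ = `|k%:C * weighted_partials bs phi (l^-1 *: x)|); last first.
  by rewrite /weighted_partials mulrCA.
rewrite normrM [leRHS]rmorphM ler_pM//.
by rewrite normc_def /= expr0n addr0 sqrtr_sqr.
Qed.

Lemma dilate_testfun l phi :
  l != 0 -> phi \in testfun_pred -> dilate_fun l phi \in testfun_pred.
Proof.
move=> l0 /asboolP[sphi cphi]; apply/asboolP; split; first exact: smooth_dilate.
have ck : compact ((fun x => l *: x) @` supp phi).
  apply: continuous_compact => //; apply: continuous_subspaceT.
  exact: scaler_continuous.
apply: (subclosed_compact _ ck); first exact: closed_closure.
rewrite /supp closureE => x; apply; split=> /=.
  apply: compact_closed => //; exact: norm_hausdorff.
move=> y /= y0; exists (l^-1 *: y); first exact: subset_closure.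
by rewrite scalerA divff// scale1r.
Qed.

HB.instance Definition _ :=
  GRing.isSubmodClosed.Build R[i] ('rV[R]_n -> R[i]) schwartz_pred
    schwartz_submod_closed.
HB.instance Definition _ :=
  GRing.isSubmodClosed.Build R[i] ('rV[R]_n -> R[i]) testfun_pred
    testfun_submod_closed.

End smooth.

Section schwartz_space.
Variables (R : realType) (n : nat).

Record schwartz := Schwartz {
  schwartz_fun :> 'rV[R]_n -> R[i] ;
  schwartzP : schwartz_fun \in schwartz_pred }.

HB.instance Definition _ := [isSub for schwartz_fun].
HB.instance Definition _ := [Choice of schwartz by <:].
HB.instance Definition _ := [SubChoice_isSubLmodule of schwartz by <:].

(* The Schwartz topology: the coarsest one making each
   [phi |-> x^b * partials s phi] continuous for uniform convergence. *)
Definition schwartz_jet (phi : schwartz) :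
    prod_topology (fun _ : {ffun 'I_n -> nat} * seq 'I_n =>
                     {uniform 'rV[R]_n -> R[i]^o}) :=
  fun bs => weighted_partials bs phi.

HB.instance Definition _ :=
  Uniform.copy schwartz (initial_topology schwartz_jet).

(* [phi(t / l)]; the default value [0] is only reached at [l = 0]. *)
Definition schwartz_dilate (l : R) (phi : schwartz) : schwartz :=
  insubd (0 : schwartz) (dilate_fun l phi).

Lemma schwartz_dilateE (l : R) (phi : schwartz) (t : 'rV[R]_n) :
  l != 0 -> schwartz_dilate l phi t = phi (l^-1 *: t).
Proof.
by move=> l0; rewrite /schwartz_dilate val_insubd dilate_schwartz//; exact: schwartzP.
Qed.

End schwartz_space.

Section testfun_space.
Variables (R : realType) (n : nat).

Record testfun := Testfun {
  testfun_fun :> 'rV[R]_n -> R[i] ;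
  testfunP : testfun_fun \in testfun_pred }.

HB.instance Definition _ := [isSub for testfun_fun].
HB.instance Definition _ := [Choice of testfun by <:].
HB.instance Definition _ := [SubChoice_isSubLmodule of testfun by <:].

Definition testfun_jet (phi : testfun) :
    prod_topology (fun _ : seq 'I_n => {uniform 'rV[R]_n -> R[i]^o}) :=
  fun s => partials s phi.

Definition absolutely_convex (W : set testfun) :=
  forall (a b : R[i]) (u v : testfun),
    `|a| + `|b| <= 1 -> W u -> W v -> W (a *: u + b *: v).

Definition testfun_in (K : set 'rV[R]_n) : set testfun :=
  [set phi | supp phi `<=` K].

(* The intersection of [W] with the space of test functions supported in [K] is
   a neighborhood of [0] for uniform convergence of all derivatives. *)
Definition nbhs0_in (K : set 'rV[R]_n) (W : set testfun) :=
  within (testfun_in K) (nbhs (0 : initial_topology testfun_jet)) W.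

(* The locally convex inductive limit topology of the spaces of test functions
   supported in a compact set. *)
Definition testfun_open (U : set testfun) :=
  forall phi, U phi -> exists W : set testfun,
    [/\ absolutely_convex W, (forall K, compact K -> nbhs0_in K W)
      & forall psi, W psi -> U (phi + psi)].

Lemma testfun_openT : testfun_open setT.
Proof.
move=> phi _; exists setT; split=> // K _.
by rewrite /nbhs0_in; exact: filterT.
Qed.

Lemma testfun_openI : setI_closed testfun_open.
Proof.
move=> A B oA oB phi [/oA [V [cV nV VA]] /oB [W [cW nW WB]]].
exists (V `&` W); split.
- by move=> a b u v ab [Vu Wu] [Vv Wv]; split; [exact: cV|exact: cW].
- move=> K cK; rewrite /nbhs0_in.
  by apply: filterI; [exact: nV|exact: nW].
- by move=> psi [/VA ? /WB ?].
Qed.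

Lemma testfun_open_bigU (I : Type) (f : I -> set testfun) :
  (forall i, testfun_open (f i)) -> testfun_open (\bigcup_i f i).
Proof.
move=> of_ phi [i _ /of_[W [cW nW Wf]]]; exists W; split=> // psi /Wf fi.
by exists i.
Qed.

HB.instance Definition _ :=
  isOpenTopological.Build testfun testfun_openT testfun_openI testfun_open_bigU.

Definition testfun_dilate (l : R) (phi : testfun) : testfun :=
  insubd (0 : testfun) (dilate_fun l phi).

Lemma testfun_dilateE (l : R) (phi : testfun) (t : 'rV[R]_n) :
  l != 0 -> testfun_dilate l phi t = phi (l^-1 *: t).
Proof.
by move=> l0; rewrite /testfun_dilate val_insubd dilate_testfun//; exact: testfunP.
Qed.

Definition testfun_schwartz (phi : testfun) : schwartz R n :=
  Schwartz (testfun_pred_schwartz (testfunP phi)).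

Lemma testfun_schwartz_is_linear : linear testfun_schwartz.
Proof. by move=> a u v; apply/val_inj. Qed.

HB.instance Definition _ :=
  GRing.isLinear.Build R[i] testfun (schwartz R n) _ testfun_schwartz
    testfun_schwartz_is_linear.

End testfun_space.

Section slowly_varying.
Context {R : realType}.
Implicit Types L : R -> R.

(* [R] with the sigma-algebra of Lebesgue (not only Borel) measurable sets. *)
Definition lebesgue_type (R : realType) :=
  g_sigma_algebraType (completed_algebra_gen (@lebesgue_measure R)).

Definition slowly_varying0 L := exists A : R,
  [/\ 0 < A,
      measurable_fun (`]0, A[ : set (lebesgue_type R)) L,
      (forall x, 0 < x < A -> 0 < L x)
    & forall a, 0 < a -> L (a * l) / L l @[l --> 0^'+] --> (1 : R)].

Definition slowly_varyingy L := exists A : R,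
  [/\ measurable_fun (`]A, +oo[ : set (lebesgue_type R)) L,
      (forall x, A < x -> 0 < L x)
    & forall a, 0 < a -> L (a * l) / L l @[l --> +oo] --> (1 : R)].

End slowly_varying.

Section quasiasymptotics.
Context {R : realType} (n : nat) {E : completeNormedModType R[i]}.

(* <f(l t), phi(t)> = l^-n <f(t), phi(t / l)>, where [dil l phi] is
   [phi(t / l)]. *)
Definition pairing_dilate (A : lmodType R[i]) (dil : R -> A -> A)
    (f : {linear A -> E}) (l : R) (phi : A) : E :=
  (l ^- n)%:C *: f (dil l phi).

Definition quasiasymptotic (A : lmodType R[i]) (dil : R -> A -> A)
    (F : set_system R) (alpha : R) (L : R -> R) (f g : {linear A -> E}) :=
  forall phi : A,
    ((l `^ alpha * L l)^-1)%:C *: pairing_dilate dil f l phi @[l --> F]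
      --> g phi.
End quasiasymptotics.

(* Main.v *)
Require Import Defs.
From HB Require Import structures.
From mathcomp Require Import all_boot all_order all_algebra.
From mathcomp Require Import complex.
From mathcomp Require Import all_classical all_reals all_analysis.
From mathcomp Require Import measurable_realfun ring lra.

Set Implicit Arguments.
Unset Strict Implicit.
Unset Printing Implicit Defensive.

Import Order.TTheory GRing.Theory Num.Theory.
Import numFieldNormedType.Exports.

Local Open Scope classical_set_scope.
Local Open Scope ring_scope.
Local Open Scope complex_scope.

(* Write [T_l phi = (l^alpha L(l))^-1 <f(l t), phi(t)>]. By hypothesis [T_l] is
   pointwise bounded on test functions, so a gliding hump (Banach-Steinhaus)
   argument makes it equicontinuous on those supported in a fixed ball. A
   Schwartz function is cut into dyadic pieces living on [|x| ~ 2^j]; the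
   dilation by [2^j] brings each piece back to the fixed ball and turns [T_l]
   into [T_(2^j l)] up to the factor [L(2^j l)/L(l) <= 2^j] times a power of
   [2^j], which rapid decrease absorbs. At the origin [2^j l] leaves the region
   where this applies; the remaining tail is estimated with the continuity of
   [f] on the Schwartz space, at the cost of a power of [1/l] and of a lower
   bound [c l <= L(l)]. Hence [T_l] is equicontinuous on the Schwartz space,
   where test functions are dense, and the limit extends. *)

(** The bound on [T_l phi] holds only for [l] in a neighborhood of the limit point that depends on
    [phi], so there is no fixed pointwise bounded family. The gliding hump therefore runs along a
    decreasing basis [Lam N] of the filter and yields a bound on a single [Lam k]. Besides the
    pointwise bounds it needs each single [T_l] to be bounded by some seminorm, which the continuity
    of [f] on the Schwartz space provides.

    The dyadic sum uses slow variation only for the ratio 2, through [L (2 * l) <= 2 * L l], so no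
    uniformity in the ratio is required there. The lower bound at the origin is different. Doubling
    carries a positive lower bound of [L l / l] from one interval [[w / 2, w]] to all smaller [l],
    but slow variation is a pointwise condition and does not by itself keep [L] away from 0 on such
    an interval. Measurability does: it provides large sets on which [L] exceeds a positive
    level. *)

(** * Norms with real values *)

Section real_norm.
Context {R : realType}.

(** Norms here take values in [R[i]], whose order is partial. A norm is nonnegative, hence real, and
    its real part is open to real arithmetic. *)
Definition rnorm (V : normedZmodType R[i]) (x : V) : R := complex.Re `|x|.

Lemma rnormE (V : normedZmodType R[i]) (x : V) : `|x| = (rnorm x)%:C.
Proof.
have := normr_ge0 x; rewrite /rnorm lecE => /andP[/eqP + _].
by case: `|x| => a b /= ->.
Qed.

Lemma rnorm_ge0 (V : normedZmodType R[i]) (x : V) : 0 <= rnorm x.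
Proof. by rewrite -lecR -rnormE normr_ge0. Qed.

Lemma rnorm0 (V : normedZmodType R[i]) : rnorm (0 : V) = 0.
Proof. by rewrite /rnorm normr0. Qed.

Lemma rnorm_eq0 (V : normedZmodType R[i]) (x : V) : rnorm x = 0 -> x = 0.
Proof. by move=> x0; apply/eqP; rewrite -normr_eq0 rnormE x0. Qed.

Lemma rnormN (V : normedZmodType R[i]) (x : V) : rnorm (- x) = rnorm x.
Proof. by rewrite /rnorm normrN. Qed.

Lemma rnormD (V : normedZmodType R[i]) (x y : V) :
  rnorm (x + y) <= rnorm x + rnorm y.
Proof. by rewrite -lecR rmorphD /= -!rnormE ler_normD. Qed.

Lemma rnormB (V : normedZmodType R[i]) (x y : V) :
  rnorm (x - y) <= rnorm x + rnorm y.
Proof. by rewrite -(rnormN y) rnormD. Qed.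

Lemma rnorm_real (r : R) : rnorm (r%:C : R[i]) = `|r|.
Proof. by rewrite /rnorm normc_def /= expr0n addr0 sqrtr_sqr. Qed.

Lemma rnormM (x y : R[i]) : rnorm (x * y) = rnorm x * rnorm y.
Proof. by apply: complexI; rewrite rmorphM /= -!rnormE normrM. Qed.

Lemma rnormZ (V : normedModType R[i]) (r : R) (x : V) :
  rnorm (r%:C *: x) = `|r| * rnorm x.
Proof.
by apply: complexI; rewrite rmorphM /= -rnorm_real -!rnormE normrZ.
Qed.

Lemma normRe_le (z : R[i]) : `|complex.Re z| <= rnorm z.
Proof. by rewrite -lecR -rnormE normc_ge_Re. Qed.

Lemma normIm_le (z : R[i]) : `|complex.Im z| <= rnorm z.
Proof.
rewrite -normrN -ReiNIm (le_trans (normRe_le _))// rnormM.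
by rewrite {2}/rnorm normc_def/= expr0n expr1n add0r sqrtr1 mulr1.
Qed.

Lemma rnorm_le_ReIm (z : R[i]) : rnorm z <= `|complex.Re z| + `|complex.Im z|.
Proof. by rewrite -lecR -rnormE normc_le_ReIm. Qed.

Lemma cvg_rnorm (V : pseudoMetricNormedZmodType R[i]) (T : Type)
    (F : set_system T) {FF : Filter F} (u : T -> V) (l : V) :
  u @ F --> l <->
  forall e : R, 0 < e -> \forall x \near F, rnorm (l - u x) < e.
Proof.
split=> [/cvgrPdist_lt ul e e0|ul].
  have := ul e%:C; rewrite ltcR => /(_ e0); apply: filterS => x.
  by rewrite rnormE ltcR.
apply/cvgrPdist_lt => -[a b]; rewrite ltcE/= => /andP[/eqP -> a0].
by have := ul a a0; apply: filterS => x; rewrite rnormE ltcR.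
Qed.

Lemma continuous_complex (T : topologicalType) (u v : T -> R) :
  continuous u -> continuous v ->
  continuous ((fun x => u x +i* v x) : T -> R[i]^o).
Proof.
move=> cu cv x; apply: (iffRL (@cvg_rnorm R[i]^o T (nbhs x) _ _ _)) => e e0.
have e20 : 0 < e / 2 by rewrite divr_gt0.
have /cvgrPdist_lt/(_ _ e20) := cu x; have /cvgrPdist_lt/(_ _ e20) := cv x.
apply: filterS2 => y vy uy; rewrite (le_lt_trans (rnorm_le_ReIm _))//=.
by rewrite [ltRHS]splitr ltrD.
Qed.

Lemma continuous_mulc (T : topologicalType) (u v : T -> R[i]^o) :
  continuous u -> continuous v ->
  continuous ((fun x => (u x : R[i]) * v x) : T -> R[i]^o).
Proof.
move=> cu cv.
have cRe (w : T -> R[i]^o) : continuous w -> continuous (fun x => complex.Re (w x)).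
  by move=> cw x; apply: continuous_comp; [exact: cw|exact: Re_continuous].
have cIm (w : T -> R[i]^o) : continuous w -> continuous (fun x => complex.Im (w x)).
  by move=> cw x; apply: continuous_comp; [exact: cw|exact: Im_continuous].
rewrite (_ : (fun x => _) = fun x =>
    (complex.Re (u x) * complex.Re (v x) - complex.Im (u x) * complex.Im (v x))
    +i* (complex.Re (u x) * complex.Im (v x) + complex.Im (u x) * complex.Re (v x))).
  have cM (p q : T -> R) : continuous p -> continuous q ->
      continuous (fun x => p x * q x).
    by move=> cp cq x; exact: (continuousM (cp x) (cq x)).
  have cD (p q : T -> R) : continuous p -> continuous q ->
      continuous (fun x => p x + q x).
    by move=> cp cq x; exact: (@continuousD _ R^o _ p q x (cp x) (cq x)).
  have cN (p : T -> R) : continuous p -> continuous (fun x => - p x).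
    by move=> cp x; exact: (@continuousN _ R^o _ p x (cp x)).
  apply: continuous_complex.
    by apply: cD; [|apply: cN]; apply: cM; [exact: cRe|exact: cRe|exact: cIm|exact: cIm].
  by apply: cD; apply: cM; [exact: cRe|exact: cIm|exact: cIm|exact: cRe].
by apply/funext => x; case: (u x) (v x) => a b [].
Qed.

End real_norm.

(** * Smooth cutoff functions *)

Section line.
Context {R : realType} {V : normedModType R}.

(** Reduces directional derivatives to functions of one real variable, where the chain rule and the
    mean value theorem apply. *)
Lemma is_derive_line (f : V -> R) (x v : V) (t d : R) :
  is_derive (t *: v + x) v f d <->
  is_derive t 1 (fun h : R => f (h *: v + x)) d.
Proof.
have E : (fun h : R => h^-1 *: ((f \o shift (t *: v + x)) (h *: v) - f (t *: v + x)))
  = (fun h : R => h^-1 *: (((fun h : R => f (h *: v + x)) \o shift t) (h *: 1)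
      - f (t *: v + x))).
  by apply/funext => h /=; rewrite addrA -scalerDl [_%:A]mulr1.
split=> -[d1 d2]; apply: DeriveDef.
- by move: d1; rewrite /derivable E.
- by rewrite -d2 /derive E.
- by move: d1; rewrite /derivable E.
- by rewrite -d2 /derive E.
Qed.

Lemma is_derive_comp_line (g : R -> R) (f : V -> R) (x v : V) (a b : R) :
  is_derive (f x) 1 g a -> is_derive x v f b ->
  is_derive x v (g \o f) (a * b).
Proof.
move=> dg df; rewrite -[x](add0r) -(scale0r v); apply/is_derive_line.
apply: (@is_derive1_comp _ g (fun h : R => f (h *: v + x))).
  by rewrite scale0r add0r.
by apply/is_derive_line; rewrite scale0r add0r.
Qed.

End line.

Section flat.
Context {R : realType}.
Implicit Types (x : R) (m : nat).

(* These functions are closed under differentiation and vanish at the origin,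
   which makes exp(-1/x) extended by zero smooth. *)
Definition flat m x : R := if 0 < x then x ^- m * expR (- x^-1) else 0.

Lemma flat_le0 m x : x <= 0 -> flat m x = 0.
Proof. by rewrite /flat ltNge => ->. Qed.

Lemma flat_ge0 m x : 0 <= flat m x.
Proof.
rewrite /flat; case: ifPn => // x0.
by rewrite mulr_ge0 ?expR_ge0// invr_ge0 exprn_ge0 ?ltW.
Qed.

(** [exp (1 / x)] is at least the term of degree [m.+1] of its Taylor series. One power of [x]
    remains, which gives the limit 0 at the origin. *)
Lemma flat_le m x : flat m x <= (m.+1)`!%:R * `|x|.
Proof.
have [x0|x0] := leP x 0; first by rewrite flat_le0// mulr_ge0.
rewrite /flat x0 expRN gtr0_norm//.
have : (x^-1) ^+ m.+1 / (m.+1)`!%:R <= expR x^-1.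
  have y0 : 0 <= x^-1 by rewrite invr_ge0 ltW.
  by apply: le_trans (expR_ge1Dxn m y0); rewrite lerDr.
have f0 : 0 < ((m.+1)`!%:R : R) by rewrite ltr0n fact_gt0.
rewrite ler_pdivrMr// => H.
have -> : x ^- m = x * x^-1 ^+ m.+1.
  by rewrite exprS mulrA divff ?gt_eqF// mul1r exprVn.
by rewrite -mulrA [leRHS]mulrC ler_pM2l// ler_pdivrMr ?expR_gt0// mulrC.
Qed.

Lemma is_derive_flat m x :
  is_derive x 1 (flat m) (flat m.+2 x - m%:R * flat m.+1 x).
Proof.
have [x0|x0|x0] := ltgtP x 0.
- rewrite !flat_le0 ?ltW// mulr0 subrr.
  apply: (@near_eq_is_derive _ _ _ (cst 0)).
  have := lt_nbhsl x0; apply: filterS => y /= y0; by rewrite flat_le0// ltW.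
- pose k (y : R) : R := (y^-1) ^+ m * expR (- y^-1).
  apply: (@near_eq_is_derive R R R k).
    by have := lt_nbhsr x0; apply: filterS => y /= y0; rewrite /k /flat y0 exprVn.
  have x0' : x != 0 by rewrite gt_eqF.
  have dV : is_derive x 1 (fun y : R => y^-1) (- x ^- 2).
    have := @is_deriveV R id x 1 1 x0' _.
    by rewrite [_ *: 1]mulr1; apply.
  have dN : is_derive x 1 (fun y : R => - y^-1) (x ^- 2).
    by rewrite -[x ^- 2]opprK; exact: is_deriveN.
  have dE : is_derive x 1 (fun y : R => expR (- y^-1)) (expR (- x^-1) * x ^- 2).
    exact: (is_derive1_comp (is_derive_expR _) dN).
  have := @is_deriveX _ _ _ m _ _ _ dV.
  move=> dX; have dM := @is_deriveM _ _ _ _ _ _ _ _ dX dE.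
  have -> : k = (fun y : R => y^-1) ^+ m * (fun y : R => expR (- y^-1)).
    by apply/funext => y; rewrite fctE exprfctE.
  apply: (is_derive_eq dM); rewrite /flat x0.
  rewrite exprfctE /GRing.scale/= -!exprVn.
  (* The derivative of the power has exponent [m.-1]; for [m = 0] its coefficient vanishes and the
     case is separate. *)
  case: m @k dX dM => [|m] k dX dM /=; first by rewrite !mul0r mulr0 subr0 addr0 expr0 !mul1r mulrC.
  rewrite ![x^-1 ^+ _.+1]exprS; move: (expR (- x^-1)) (m.+1%:R : R) (x^-1) => e c y; ring.
- rewrite x0 !flat_le0// mulr0 subrr.
  have : (fun h => h^-1 *: ((flat m \o shift (0 : R)) (h *: 1) - flat m 0)) @ 0^' --> 0.
    (* The difference quotient of [flat m] at the origin is [flat m.+1] itself. *)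
    rewrite (_ : (fun h => _) = flat m.+1); last first.
      apply/funext => h /=; rewrite addr0 [_%:A]mulr1 (flat_le0 m (lexx 0)) subr0.
      rewrite /flat; case: ifP => _; last by rewrite scaler0.
      by rewrite /GRing.scale/= mulrA exprS invfM.
    apply/cvgr0Pnorm_lt => e e0; near=> h.
    rewrite ger0_norm ?flat_ge0// (le_lt_trans (flat_le _ _))//.
    have f0 : 0 < ((m.+2)`!%:R : R) by rewrite ltr0n fact_gt0.
    rewrite -ltr_pdivlMl//; near: h; apply: dnbhs0_lt.
    by rewrite mulr_gt0 ?invr_gt0.
  move=> H; apply: DeriveDef; last exact: cvg_lim H.
  by apply/cvg_ex; exists 0.
Unshelve. all: by end_near. Qed.

Lemma continuous_flat m : continuous (flat m).
Proof.
move=> x; have [d _] := is_derive_flat m x.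
exact/differentiable_continuous/derivable1_diffP.
Qed.

End flat.

Section coordinates.
Context {R : realType} {n : nat}.
Implicit Types x : 'rV[R]_n.

Lemma norm_coord_le x i : `|x 0 i| <= `|x|.
Proof.
rewrite [leRHS]/Num.Def.normr/= mx_normrE; apply/bigmax_geP; right => /=.
by exists (0, i).
Qed.

(** The norm is the maximum norm. Positivity excludes [n = 0], where there is no coordinate. *)
Lemma norm_coord_max x : 0 < `|x| -> exists i, `|x| = `|x 0 i|.
Proof.
move=> x0; have /mx_norm_neq0[[j i] /= E] : mx_norm x != 0 by rewrite gt_eqF.
by exists i; rewrite [LHS]E ord1.
Qed.

Definition supported (r : R) (phi : 'rV[R]_n -> R[i]) :=
  forall x, r < `|x| -> phi x = 0.

Lemma supp_supported r phi x : supported r phi -> supp phi x -> `|x| <= r.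
Proof.
move=> phi0; rewrite /supp closureE => /(_ [set y | `|y| <= r]); apply.
split=> [|y /=].
  apply: (@preimage_closed _ _ (fun y : 'rV[R]_n => `|y|) [set z | z <= r]).
    by move=> y _; exact: norm_continuous.
  exact: closed_le.
by apply: contraNP => /negP; rewrite -ltNge => /phi0 ->.
Qed.

Lemma supported_partials r phi s :
  supported r phi -> supported r (partials s phi).
Proof.
by move=> phi0 x rx; apply: partials_supp => /(supp_supported phi0); rewrite leNgt rx.
Qed.

Lemma compact_supp r phi : supported r phi -> compact (supp phi).
Proof.
move=> phi0; apply: bounded_closed_compact; last exact: closed_closure.
exists r; split; first by rewrite num_real.
move=> M rM x /(supp_supported phi0) xr; exact: le_trans xr (ltW rM).
Qed.

(** A class that contains the cutoff and is stable under partial derivatives, so that smoothness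
    needs no formula for iterated derivatives. *)
Inductive elementary : ('rV[R]_n -> R) -> Prop :=
| elementary_cst c : elementary (fun=> c)
| elementary_coord i : elementary (fun x => x 0 i)
| elementaryD u v : elementary u -> elementary v ->
    elementary (fun x => u x + v x)
| elementaryM u v : elementary u -> elementary v ->
    elementary (fun x => u x * v x)
| elementary_flat m u : elementary u -> elementary (fun x => flat m (u x)).

Lemma elementary_prod (I : Type) (r : seq I) (F : I -> 'rV[R]_n -> R) :
  (forall i, elementary (F i)) -> elementary (fun x => \prod_(i <- r) F i x).
Proof.
move=> eF; elim: r => [|i r IH].
  under eq_fun do rewrite big_nil; exact: elementary_cst.
under eq_fun do rewrite big_cons; exact: elementaryM.
Qed.

Lemma elementary_continuous u : elementary u -> continuous u.
Proof.
elim=> [c|i|{}u v _ cu _ cv|{}u v _ cu _ cv|m {}u _ cu] x.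
- exact: cst_continuous.
- exact: coord_continuous.
- by apply: continuousD; [exact: cu|exact: cv].
- by apply: continuousM; [exact: cu|exact: cv].
- by apply: continuous_comp; [exact: cu|exact: continuous_flat].
Qed.

Lemma elementary_partial u i : elementary u -> exists2 u', elementary u' &
  forall x, is_derive x (delta_mx 0 i) u (u' x).
Proof.
elim=> [c|j|{}u v eu [u' eu' du] ev [v' ev' dv]|
        {}u v eu [u' eu' du] ev [v' ev' dv]|m {}u eu [u' eu' du]].
- exists (fun=> 0); first exact: elementary_cst.
  by move=> x; exact: is_derive_cst.
- exists (fun=> (delta_mx 0 i : 'rV[R]_n) 0 j); first exact: elementary_cst.
  move=> x; rewrite -[x](add0r) -(scale0r (delta_mx 0 i)).
  apply/is_derive_line.
  pose c := (delta_mx 0 i : 'rV[R]_n) 0 j.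
  rewrite (_ : (fun h => _) = (c *: id + cst (x 0 j) : R -> R)); last first.
    by apply/funext => h; rewrite 2!mxE -/c mulrC.
  apply: (is_derive_eq (@is_deriveD R R R (c *: id) (cst (x 0 j)) 0 1 (c *: 1) 0 _ _)).
  by rewrite addr0 [c *: 1]mulr1.
- exists (fun x => u' x + v' x); first exact: elementaryD.
  by move=> x; exact: is_deriveD.
- exists (fun x => u x * v' x + v x * u' x).
    by apply: elementaryD; exact: elementaryM.
  by move=> x; exact: is_deriveM.
- exists (fun x => (flat m.+2 (u x) + (- m%:R) * flat m.+1 (u x)) * u' x).
    apply: elementaryM => //; apply: elementaryD; first exact: elementary_flat.
    by apply: elementaryM; [exact: elementary_cst|exact: elementary_flat].
  move=> x; apply: is_derive_comp_line => //; rewrite mulNr.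
  exact: is_derive_flat.
Qed.

Lemma smooth_elementary u : elementary u -> smooth (fun x => (u x)%:C).
Proof.
move=> eu; have {}eu s : exists2 u', elementary u' &
    partials s (fun x => (u x)%:C) = fun x => (u' x)%:C.
  elim: s => [|i s [u' eu' E]]; first by exists u.
  have [u2 eu2 du2] := elementary_partial i eu'; exists u2 => //.
  apply/funext => x /=; rewrite E /partial /=.
  by rewrite derive_cst (@derive_val _ _ _ _ _ _ _ (du2 x)).
move=> s; have [u' eu' ->] := eu s; split.
  apply: continuous_complex; first exact: elementary_continuous.
  exact: cst_continuous.
move=> i x /=; split; last exact: derivable_cst.
by have [u2 _ /(_ x)[]] := elementary_partial i eu'.
Qed.

(** For [|t| <= 1] the inner [flat] vanishes and the outer one equals [exp (-1)], whence the factor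
    [expR 1]. For [|t| >= 2] the inner one is at least [1 - 1 / 3 > 1 / 2], so the argument of the
    outer one is negative. *)
Definition bump (t : R) : R := expR 1 * flat 0 (1 - 2 * flat 0 (t ^+ 2 - 1)).

Lemma bump1 t : `|t| <= 1 -> bump t = 1.
Proof.
move=> t1; rewrite /bump (flat_le0 0 (x := t ^+ 2 - 1)); last first.
  by rewrite subr_le0 -real_normK ?num_real// exprn_ile1.
by rewrite mulr0 subr0 /flat ltr01 expr0 invr1 mul1r -expRD subrr expR0.
Qed.

Lemma bump0 t : 2 <= `|t| -> bump t = 0.
Proof.
move=> t2; rewrite /bump (flat_le0 0) ?mulr0// subr_le0.
have t3 : 3 <= t ^+ 2 - 1.
  by rewrite -real_normK ?num_real//; move: (`|t|) t2 => a; nra.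
have t0 : 0 < t ^+ 2 - 1 by lra.
have : (t ^+ 2 - 1)^-1 <= 3^-1 by rewrite lef_pV2// posrE.
rewrite /flat t0 expr0 invr1 mul1r; have := expR_ge1Dx (- (t ^+ 2 - 1)^-1).
move: (_^-1) (expR _) => a b; lra.
Qed.

Definition cutoff (x : 'rV[R]_n) : R := \prod_i bump (x 0 i).

Lemma elementary_cutoff : elementary cutoff.
Proof.
apply: elementary_prod => i; apply: elementaryM; first exact: elementary_cst.
apply: elementary_flat.
pose f := @elementary_flat 0 _ (elementaryD
  (elementaryM (elementary_coord i) (elementary_coord i)) (elementary_cst (-1))).
have := elementaryD (elementary_cst 1) (elementaryM (elementary_cst (-2)) f).
rewrite (_ : (fun x => _) = fun x => 1 - 2 * flat 0 (x 0 i ^+ 2 - 1))//.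
by apply/funext => x; rewrite mulNr expr2.
Qed.

Lemma cutoff1 x : `|x| <= 1 -> cutoff x = 1.
Proof.
move=> x1; rewrite /cutoff big1// => i _; apply: bump1.
exact: le_trans (norm_coord_le x i) x1.
Qed.

Lemma cutoff0 x : 2 <= `|x| -> cutoff x = 0.
Proof.
move=> x2; have [|i E] := @norm_coord_max x; first exact: lt_le_trans x2.
by rewrite /cutoff (bigD1 i)//= bump0 ?mul0r// -E.
Qed.

Lemma testfun_cutoff : (fun x => (cutoff x)%:C) \in testfun_pred.
Proof.
apply/asboolP; split; first exact/smooth_elementary/elementary_cutoff.
by apply: (@compact_supp 2) => x /ltW /cutoff0 ->.
Qed.

End coordinates.

(** * Products and limits of smooth functions *)

Section leibniz.
Context {R : realType} {n : nat}.
Implicit Types (u v w : 'rV[R]_n -> R[i]) (x : 'rV[R]_n).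

Definition pderivable (i : 'I_n) w := forall x,
  derivable (fun y => complex.Re (w y)) x (delta_mx 0 i) /\
  derivable (fun y => complex.Im (w y)) x (delta_mx 0 i).

Lemma partialD i u v : pderivable i u -> pderivable i v ->
  pderivable i (fun x => u x + v x) /\
  partial i (fun x => u x + v x) = fun x => partial i u x + partial i v x.
Proof.
move=> du dv; have := partial_lin 1 du dv.
by rewrite (scale1r u) (scale1r (partial i u)).
Qed.

Lemma partialM i u v : pderivable i u -> pderivable i v ->
  pderivable i (fun x => u x * v x) /\
  partial i (fun x => u x * v x) =
    fun x => partial i u x * v x + u x * partial i v x.
Proof.
move=> du dv.
pose Ru x := complex.Re (u x); pose Iu x := complex.Im (u x).
pose Rv x := complex.Re (v x); pose Iv x := complex.Im (v x).
have ReE : (fun y => complex.Re (u y * v y)) = Ru * Rv - Iu * Iv.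
  by apply/funext => y; rewrite !fctE /Ru /Iu /Rv /Iv; case: (u y) (v y) => ? ? [].
have ImE : (fun y => complex.Im (u y * v y)) = Ru * Iv + Iu * Rv.
  by apply/funext => y; rewrite !fctE /Ru /Iu /Rv /Iv; case: (u y) (v y) => ? ? [].
have dRu x : derivable Ru x (delta_mx 0 i) by exact: (du x).1.
have dIu x : derivable Iu x (delta_mx 0 i) by exact: (du x).2.
have dRv x : derivable Rv x (delta_mx 0 i) by exact: (dv x).1.
have dIv x : derivable Iv x (delta_mx 0 i) by exact: (dv x).2.
have dRR x := derivableM (dRu x) (dRv x); have dII x := derivableM (dIu x) (dIv x).
have dRI x := derivableM (dRu x) (dIv x); have dIR x := derivableM (dIu x) (dRv x).
rewrite /pderivable /partial ReE ImE; split=> [x|].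
  by split; [exact: (derivableB (dRR x) (dII x))|exact: (derivableD (dRI x) (dIR x))].
apply/funext => x.
rewrite (deriveB (dRR x) (dII x)) (deriveD (dRI x) (dIR x)).
rewrite (deriveM (dRu x) (dRv x)) (deriveM (dIu x) (dIv x)).
rewrite (deriveM (dRu x) (dIv x)) (deriveM (dIu x) (dRv x)).
rewrite -/Ru -/Iu -/Rv -/Iv /GRing.scale/=.
rewrite (_ : u x = Ru x +i* Iu x); last by rewrite /Ru /Iu; case: (u x).
rewrite (_ : v x = Rv x +i* Iv x); last by rewrite /Rv /Iv; case: (v x).
move: (Ru x) (Iu x) (Rv x) (Iv x) ('D_(delta_mx 0 i) Ru x)
  ('D_(delta_mx 0 i) Iu x) ('D_(delta_mx 0 i) Rv x) ('D_(delta_mx 0 i) Iv x).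
move=> a b c d a' b' c' d'.
by apply/eqP; rewrite eq_complex/=; apply/andP; split; apply/eqP; ring.
Qed.

(* Sums of [c] products of one derivative of [u] and one of [v], of total
   order [k]. *)
Inductive leibniz u v : nat -> nat -> ('rV[R]_n -> R[i]) -> Prop :=
| leibniz_prod a b :
    leibniz u v (size a + size b) 1 (fun x => partials a u x * partials b v x)
| leibniz_add k c c' w w' : leibniz u v k c w -> leibniz u v k c' w' ->
    leibniz u v k (c + c') (fun x => w x + w' x).

(** The product rule turns each term into two terms of order one higher. Since only bounds are
    wanted, the terms are counted and not identified. *)
Lemma leibniz_partial i u v k c w : smooth u -> smooth v ->
  leibniz u v k c w -> pderivable i w /\ leibniz u v k.+1 (2 * c) (partial i w).
Proof.
move=> su sv; elim=> [a b|{}k {}c c' {}w w' _ [dw lw] _ [dw' lw']].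
  have [d ->] := partialM ((su a).2 i) ((sv b).2 i); split=> //.
  apply: (leibniz_add (c := 1) (c' := 1)).
    exact: (leibniz_prod u v (i :: a) b).
  by rewrite -addnS; exact: (leibniz_prod u v a (i :: b)).
by have [d ->] := partialD dw dw'; split=> //; rewrite mulnDr; exact: leibniz_add.
Qed.

Lemma leibniz_partials s u v : smooth u -> smooth v ->
  leibniz u v (size s) (2 ^ size s) (partials s (fun x => u x * v x)).
Proof.
move=> su sv; elim: s => [|i s IH] /=; first exact: (leibniz_prod u v [::] [::]).
by rewrite expnS; have [] := leibniz_partial i su sv IH.
Qed.

Lemma leibniz_continuous u v k c w : smooth u -> smooth v ->
  leibniz u v k c w -> continuous (w : 'rV[R]_n -> R[i]^o).
Proof.
move=> su sv; elim=> [a b|{}k {}c c' {}w w' _ cw _ cw'].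
  exact: continuous_mulc (su a).1 (sv b).1.
by move=> x; exact: (@continuousD _ R[i]^o _ w w' x (cw x) (cw' x)).
Qed.

Lemma smoothM u v : smooth u -> smooth v -> smooth (fun x => u x * v x).
Proof.
move=> su sv s; have ls := leibniz_partials s su sv.
split; first exact: leibniz_continuous su sv ls.
by move=> i; have [] := leibniz_partial i su sv ls.
Qed.

Lemma leibniz_le u v k c w x (A B : R) : leibniz u v k c w ->
  (forall a, (size a <= k)%N -> rnorm (partials a u x) <= A) ->
  (forall b, (size b <= k)%N -> rnorm (partials b v x) <= B) ->
  rnorm (w x) <= c%:R * (A * B).
Proof.
elim=> [a b|{}k {}c c' {}w w' _ lw _ lw'] uA vB.
  rewrite mul1r rnormM ler_pM ?rnorm_ge0//; first exact/uA/leq_addr.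
  exact/vB/leq_addl.
by rewrite natrD mulrDl (le_trans (rnormD _ _))// lerD// ?lw ?lw'.
Qed.

Lemma partialsM_le u v s x (A B : R) : smooth u -> smooth v ->
  (forall a, (size a <= size s)%N -> rnorm (partials a u x) <= A) ->
  (forall b, (size b <= size s)%N -> rnorm (partials b v x) <= B) ->
  rnorm (partials s (fun y => u y * v y) x) <= 2 ^+ size s * (A * B).
Proof.
move=> su sv uA vB; rewrite -natrX.
exact: leibniz_le (leibniz_partials s su sv) uA vB.
Qed.

End leibniz.

(** * Termwise differentiation *)

Section limit_of_derivatives.
Context {R : realType}.

Lemma mean_value_le (f df : R -> R) (C a b : R) :
  (forall t : R, is_derive t 1 f (df t)) -> (forall t, `|df t| <= C) ->
  `|f b - f a| <= C * `|b - a|.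
Proof.
move=> fdf dfC; wlog ab : a b / a <= b.
  by move=> H; have [/H//|/ltW/H] := leP a b; rewrite distrC (distrC b).
have [|c _ ->] := MVT_segment ab (fun x _ => fdf x).
  apply: continuous_subspaceT => x; have [d _] := fdf x.
  exact/differentiable_continuous/derivable1_diffP.
by rewrite normrM ler_wpM2r.
Qed.

(** The mean value inequality for [u M - u N0] compares their difference quotients uniformly in the
    increment; letting [M] tend to infinity compares those of [U] and [u N0]. *)
Lemma is_derive_limit (V : normedModType R) (v : V) (u w : nat -> V -> R)
    (U W : V -> R) :
  (forall N x, is_derive x v (u N) (w N x)) ->
  (forall x, u ^~ x @ \oo --> U x) ->
  (forall e, 0 < e -> exists N0, forall N, (N0 <= N)%N ->
     forall x, `|w N x - W x| <= e) ->
  forall x, is_derive x v U (W x).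
Proof.
move=> duw uU wW x.
have cvgU : (fun h => h^-1 *: ((U \o shift x) (h *: v) - U x)) @ 0^' --> W x.
  (* The estimates [q1], [q2] and [q3] below cost [d], [d] and [2 * d]. *)
  apply/cvgrPdist_lt => e e0; pose d := e / 4.
  have d0 : 0 < d by rewrite divr_gt0.
  have [N0 HN0] := wW _ d0.
  have step h M : (N0 <= M)%N ->
      `|(u M (h *: v + x) - u N0 (h *: v + x)) - (u M x - u N0 x)|
        <= 2 * d * `|h|.
    move=> NM; pose f t := u M (t *: v + x) - u N0 (t *: v + x).
    have := @mean_value_le f
      (fun t => w M (t *: v + x) - w N0 (t *: v + x)) (2 * d) 0 h.
    rewrite /f scale0r add0r subr0; apply.
      move=> t; have d1 := iffLR (is_derive_line _ _ _ _ _) (duw M (t *: v + x)).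
      have d2 := iffLR (is_derive_line _ _ _ _ _) (duw N0 (t *: v + x)).
      exact: (is_deriveB d1 d2).
    move=> t; rewrite -(subrK (W (t *: v + x)) (w M _)) -addrA.
    rewrite mulr_natl mulr2n (le_trans (ler_normD _ _))// lerD//; first exact: HN0.
    by rewrite distrC; exact: HN0.
  have stepU h : `|(U (h *: v + x) - u N0 (h *: v + x)) - (U x - u N0 x)|
      <= 2 * d * `|h|.
    have cv : (fun M => `|(u M (h *: v + x) - u N0 (h *: v + x)) - (u M x - u N0 x)|)
        @ \oo --> `|(U (h *: v + x) - u N0 (h *: v + x)) - (U x - u N0 x)|.
      by apply: cvg_norm; apply: cvgB; apply: cvgB => //; exact: cvg_cst.
    rewrite -(cvg_lim _ cv)//; apply: limr_le; first by apply/cvg_ex; eexists; exact: cv.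
    by exists N0 => // M /= /step.
  have [/cvgrPdist_lt/(_ _ d0) dN0 DN0] := duw N0 x.
  near=> h.
  have h0 : h != 0 by near: h; exact: nbhs_dnbhs_neq.
  have hh : 0 < `|h| by rewrite normr_gt0.
  have q1 : `|w N0 x - h^-1 *: (u N0 (h *: v + x) - u N0 x)| < d.
    by rewrite -DN0; near: h; exact: dN0.
  have q2 : `|w N0 x - W x| <= d by exact: HN0.
  have q3 : `|h^-1 *: (U (h *: v + x) - U x) -
      h^-1 *: (u N0 (h *: v + x) - u N0 x)| <= 2 * d.
    rewrite -scalerBr normrZ normfV ler_pdivrMl// mulrC; apply: le_trans (stepU h).
    rewrite le_eqVlt; apply/orP; left; apply/eqP; congr (`|_|); ring.
  rewrite /=; move: q1 q2 q3 => /=.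
  move: (h^-1 *: (u _ _ - _)) (h^-1 *: (U _ - _)) (w N0 x) (W x) => a b c c'.
  by rewrite ltr_norml !ler_norml ltr_norml /d => /andP[? ?] /andP[? ?] /andP[? ?];
    apply/andP; split; lra.
apply: DeriveDef; last exact: cvg_lim cvgU.
by apply/cvg_ex; exists (W x).
Unshelve. all: by end_near. Qed.

(** The uniform limits [F s] are a priori unrelated. Termwise differentiation makes [F (i :: s)] the
    derivative of [F s], hence all of them derivatives of [F [::]]. *)
Lemma smooth_limit n (phi : nat -> 'rV[R]_n -> R[i])
    (F : seq 'I_n -> 'rV[R]_n -> R[i]) :
  (forall N, smooth (phi N)) ->
  (forall s e, 0 < e -> exists N0, forall N, (N0 <= N)%N ->
     forall x, rnorm (partials s (phi N) x - F s x) <= e) ->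
  smooth (F [::]) /\ forall s, partials s (F [::]) = F s.
Proof.
move=> sphi phiF.
have cF s : continuous (F s : 'rV[R]_n -> R[i]^o).
  move=> x; apply: (iffRL (@cvg_rnorm _ R[i]^o _ (nbhs x) _ _ _)) => e e0.
  have e30 : 0 < e / 3 by rewrite divr_gt0.
  have [N0 /(_ _ (leqnn _)) HN0] := phiF s _ e30.
  have /(iffLR (@cvg_rnorm _ R[i]^o _ (nbhs x) _ _ _))/(_ _ e30) := (sphi N0 s).1 x.
  apply: filterS => y /=; have := HN0 x; have := HN0 y.
  rewrite -(rnormN (_ - F s x)).
  move: (partials s _ x) (partials s _ y) (F s x) (F s y) => a b c c'.
  rewrite (_ : c - c' = - (a - c) + (a - b) + (b - c')); last by ring.
  have := rnormD (- (a - c) + (a - b)) (b - c'); have := rnormD (- (a - c)) (a - b).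
  lra.
(* [c] is the real or the imaginary part, both 1-Lipschitz. *)
have lim_part (c : R[i] -> R) s i :
    (forall z z', `|c z - c z'| <= rnorm (z - z')) ->
    (forall N x, is_derive x (delta_mx 0 i) (fun y => c (partials s (phi N) y))
       (c (partials (i :: s) (phi N) x))) ->
    forall x, is_derive x (delta_mx 0 i) (fun y => c (F s y)) (c (F (i :: s) x)).
  move=> clip dc; apply: (is_derive_limit dc).
    move=> x; apply/cvgrPdist_le => e e0; have [N0 HN0] := phiF s e e0.
    exists N0 => // N /= /HN0/(_ x); rewrite -rnormN opprB.
    exact: le_trans (clip _ _).
  move=> e e0; have [N0 HN0] := phiF (i :: s) e e0; exists N0 => N NN x.
  by apply: le_trans (HN0 _ NN x).
have dRe s i x : is_derive x (delta_mx 0 i) (fun y => complex.Re (F s y))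
    (complex.Re (F (i :: s) x)).
  apply: lim_part => [z z'|N {}x].
    by have := normRe_le (z - z'); case: z z' => ? ? [].
  have [d _] := (sphi N s).2 i x; exact: derivableP d.
have dIm s i x : is_derive x (delta_mx 0 i) (fun y => complex.Im (F s y))
    (complex.Im (F (i :: s) x)).
  apply: lim_part => [z z'|N {}x].
    by have := normIm_le (z - z'); case: z z' => ? ? [].
  have [_ d] := (sphi N s).2 i x; exact: derivableP d.
have E s : partials s (F [::]) = F s.
  elim: s => //= i s ->; apply/funext => x; rewrite /partial.
  rewrite (@derive_val _ _ _ _ _ _ _ (dRe s i x)) (@derive_val _ _ _ _ _ _ _ (dIm s i x)).
  by case: (F _ _).
split=> // s; rewrite E; split; first exact: cF.
move=> i x; have [dr _] := dRe s i x; have [di _] := dIm s i x.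
by split.
Qed.

End limit_of_derivatives.

(** * Seminorms on the Schwartz space *)

Section seminorms.
Context {R : realType} {n : nat}.
Implicit Types (s : seq 'I_n) (u v : 'rV[R]_n -> R[i]) (phi psi : schwartz R n)
  (x : 'rV[R]_n) (k m : nat) (M : R).

Lemma partialsB s u v : smooth u -> smooth v ->
  partials s (u - v) = partials s u - partials s v.
Proof.
move=> su sv; rewrite addrC -scaleN1r partials_lin//.
by rewrite scaleN1r addrC.
Qed.

Lemma schwartz_smooth phi : smooth phi.
Proof. by have /asboolP[] := schwartzP phi. Qed.

Lemma schwartz_rapid phi : rapidly_decreasing phi.
Proof. by have /asboolP[] := schwartzP phi. Qed.

(** A seminorm bound in relational form, which avoids a supremum and the question of its finiteness.
    [k] is the order of derivatives and [m] the decay; unlike monomials, the radial weight grows in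
    every direction. *)
Definition sbound k m u M := forall s, (size s <= k)%N -> forall x,
  (1 + `|x|) ^+ m * rnorm (partials s u x) <= M.

Lemma weight_ge0 m x : 0 <= (1 + `|x|) ^+ m.
Proof. by rewrite exprn_ge0// addr_ge0. Qed.

Lemma sbound_ge0 k m u M : sbound k m u M -> 0 <= M.
Proof.
move=> /(_ [::] (leq0n k) 0); apply: le_trans.
by rewrite mulr_ge0// ?weight_ge0// rnorm_ge0.
Qed.

Lemma sbound_le k m k' m' u M M' :
  (k <= k')%N -> (m <= m')%N -> M' <= M -> sbound k' m' u M' -> sbound k m u M.
Proof.
move=> kk mm MM b s sk x; apply: le_trans MM; apply: le_trans (b s _ x).
  by rewrite ler_wpM2r ?rnorm_ge0// ler_weXn2l// lerDl.
exact: leq_trans sk kk.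
Qed.

Lemma sbound_partials k m u M s x : sbound k m u M -> (size s <= k)%N ->
  rnorm (partials s u x) <= M.
Proof.
move=> b sk; apply: le_trans (b s sk x).
by rewrite ler_peMl ?rnorm_ge0// exprn_ege1// lerDl.
Qed.

Lemma sboundZ k m phi M (c : R) :
  sbound k m phi M -> sbound k m (c%:C *: phi) (`|c| * M).
Proof.
move=> b s sk x; rewrite -[c%:C *: _]addr0 partials_lin; last exact: smooth0.
  rewrite partials0 addr0 [X in rnorm X](_ : _ = c%:C * partials s phi x)//.
  rewrite rnormM rnorm_real mulrCA ler_wpM2l//; exact: b.
exact: schwartz_smooth.
Qed.

(** There are finitely many directions, hence finitely many derivatives of order at most [k];
    separate estimates can thus be merged into one. *)
Lemma seqs_upto k : exists L : seq (seq 'I_n),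
  forall s, (size s <= k)%N -> s \in L.
Proof.
elim: k => [|k [L HL]]; first by exists [:: [::]] => -[].
exists ([::] :: [seq i :: s | i <- enum 'I_n, s <- L]) => -[|i s]//= sk.
rewrite inE; apply/orP; right; apply/allpairsP; exists (i, s) => /=.
by rewrite mem_enum HL.
Qed.

Lemma filter_size_le (T : Type) (F : set_system T) (FF : Filter F) k
    (P : seq 'I_n -> set T) :
  (forall s, (size s <= k)%N -> F (P s)) ->
  F [set t | forall s, (size s <= k)%N -> P s t].
Proof.
move=> FP; have [L HL] := seqs_upto k.
suff : F [set t | forall s, s \in L -> (size s <= k)%N -> P s t].
  by apply: filterS => t H s sk; apply: H => //; exact: HL.
elim: L {HL} => [|s L IH]; first by apply: filterS filterT => t _.
have Hs : F [set t | (size s <= k)%N -> P s t].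
  have [sk|sk] := boolP (size s <= k)%N; first by apply: filterS (FP _ sk) => t + _; exact.
  by apply: filterS filterT => t _.
apply: filterS2 IH Hs => t IHt Pt s'.
by rewrite inE => /orP[/eqP -> //|]; exact: IHt.
Qed.

(** By monotonicity each [P s] holds in the neighborhood filter of infinity, and filters admit
    finite intersections. *)
Lemma uniform_size_le (P : seq 'I_n -> R -> Prop) k :
  (forall s M M', P s M -> M <= M' -> P s M') -> (forall s, exists M, P s M) ->
  exists M, forall s, (size s <= k)%N -> P s M.
Proof.
move=> Pmon Pex.
have [|M HM] := @filter_ex R (pinfty_nbhs R) _
    [set M | forall s, (size s <= k)%N -> P s M]; last by exists M.
apply: filter_size_le => s _; have [M PM] := Pex s; exists M.
by split; [rewrite num_real|move=> M' /ltW; exact: Pmon].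
Qed.

Definition coord_power m (i : 'I_n) : {ffun 'I_n -> nat} :=
  [ffun j => if j == i then m else 0%N].

Lemma monomial_coord_power m i x : monomial (coord_power m i) x = x 0 i ^+ m.
Proof.
rewrite /monomial (bigD1 i)//= ffunE eqxx big1 ?mulr1// => j /negPf ji.
by rewrite ffunE ji expr0.
Qed.

(** If [|x| > 1], then [|x|] is the absolute value of one coordinate and [1 + |x| <= 2 |x|]. With
    [monomial_le], this compares the radial weights with the monomials that define the topology. *)
Lemma weight_le m x :
  (1 + `|x|) ^+ m <= 2 ^+ m * (1 + \sum_i `|monomial (coord_power m i) x|).
Proof.
have S0 : 0 <= \sum_i `|monomial (coord_power m i) x| by exact: sumr_ge0.
have [x1|x1] := leP `|x| 1.
  apply: (@le_trans _ _ (2 ^+ m)); last by rewrite ler_peMr ?exprn_ge0// lerDl.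
  by rewrite lerXn2r ?nnegrE ?addr_ge0//; lra.
have [|i E] := @norm_coord_max _ _ x; first exact: lt_trans x1.
apply: (@le_trans _ _ ((2 * `|x|) ^+ m)).
  by rewrite lerXn2r ?nnegrE ?addr_ge0 ?mulr_ge0//; lra.
rewrite exprMn ler_wpM2l ?exprn_ge0// E -normrX (bigD1 i)//=.
rewrite monomial_coord_power addrCA lerDl addr_ge0//.
exact: sumr_ge0.
Qed.

Lemma monomial_le (b : {ffun 'I_n -> nat}) x :
  `|monomial b x| <= (1 + `|x|) ^+ (\sum_i b i).
Proof.
rewrite /monomial normr_prod -prodrXr ler_prod// => i _.
rewrite normr_ge0 normrX lerXn2r ?nnegrE ?addr_ge0//.
by rewrite (le_trans (norm_coord_le x i))// lerDr.
Qed.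

Lemma rnorm_weighted bs u x : rnorm (weighted_partials bs u x) =
  `|monomial bs.1 x| * rnorm (partials bs.2 u x).
Proof. by rewrite /weighted_partials rnormM rnorm_real. Qed.

Lemma weight_mul_le m x (d M : R) : 0 <= d -> d <= M ->
  (forall i, `|monomial (coord_power m i) x| * d <= M) ->
  (1 + `|x|) ^+ m * d <= 2 ^+ m * (1 + n%:R) * M.
Proof.
move=> d0 dM H; apply: (le_trans (ler_wpM2r d0 (weight_le m x))).
rewrite -!mulrA ler_wpM2l ?exprn_ge0// !mulrDl !mul1r lerD//.
rewrite mulr_suml (le_trans (ler_sum _ (fun i _ => H i)))//.
by rewrite sumr_const card_ord mulr_natl.
Qed.

Definition no_power : {ffun 'I_n -> nat} := [ffun=> 0%N].

Lemma monomial_no_power x : monomial no_power x = 1.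
Proof. by rewrite /monomial big1// => i _; rewrite ffunE expr0. Qed.

Lemma schwartz_sbound k m phi : exists M, sbound k m phi M.
Proof.
have [s M M'||M HM] := @uniform_size_le (fun s M => forall x,
    (1 + `|x|) ^+ m * rnorm (partials s phi x) <= M) k.
- by move=> H MM x; exact: le_trans MM.
- move=> s.
  have rapid bs : exists M, forall x, `|monomial bs.1 x| * rnorm (partials bs.2 phi x) <= M.
    have [M HM] := schwartz_rapid phi bs; exists M => x.
    by have := HM x; rewrite rnormE lecR rnorm_weighted.
  have [M0 HM0] := rapid (no_power, s).
  have [Mi HMi] := choice (fun i => rapid (coord_power m i, s)).
  exists (2 ^+ m * (1 + n%:R) * (`|M0| + \sum_i `|Mi i|)) => x.
  have S0 : 0 <= \sum_i `|Mi i| by exact: sumr_ge0.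
  apply: weight_mul_le; first exact: rnorm_ge0.
    have := HM0 x; rewrite /= monomial_no_power normr1 mul1r => H.
    by rewrite (le_trans H)// (le_trans (ler_norm _))// lerDl.
  move=> i; apply: (le_trans (HMi i x)); rewrite (le_trans (ler_norm _))//.
  rewrite (bigD1 i)//= addrCA lerDl addr_ge0//; exact: sumr_ge0.
- by exists M => s sk x; exact: HM.
Qed.

Lemma cvg_initial (S : choiceType) (T : topologicalType) (f : S -> T)
    (F : set_system S) (s : S) : Filter F -> f @ F --> f s ->
  F --> (s : initial_topology f).
Proof.
move=> FF cF A [_ [[B oB <-] Bs sBA]]; rewrite nbhs_filterE.
by apply: filterS sBA _; apply: cF; exact: open_nbhs_nbhs.
Qed.

Lemma cvg_schwartz (F : set_system (schwartz R n)) phi : Filter F ->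
  (forall bs e, 0 < e -> \forall psi \near F,
     forall x, rnorm (weighted_partials bs phi x - weighted_partials bs (schwartz_fun psi) x) < e) ->
  F --> phi.
Proof.
move=> FF HF; apply: cvg_initial; apply/cvg_sup => bs.
apply: cvg_initial => A /uniform_nbhs[E [entE EA]].
move: entE; rewrite -entourage_ballE => -[e /= e0 eE].
have Ee : e = (complex.Re e)%:C.
  by move: e0; case: (e) => a b; rewrite ltcE/= => /andP[/eqP -> _].
have e0' : 0 < complex.Re e by rewrite -ltcR -Ee.
apply: filterS (HF bs _ e0') => psi H; apply: EA => y _; apply: eE => /=.
by rewrite -ball_normE/= rnormE Ee ltcR; exact: H.
Qed.

Lemma near_weighted phi bs e : 0 < e ->
  \forall psi \near phi, forall x,
    rnorm (weighted_partials bs phi x - weighted_partials bs (schwartz_fun psi) x) < e.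
Proof.
move=> e0; pose J (psi : schwartz R n) :
  {uniform 'rV[R]_n -> R[i]^o} := weighted_partials bs psi.
have cJ : {for phi, continuous J}.
  pose T := fun _ : {ffun 'I_n -> nat} * seq 'I_n => {uniform 'rV[R]_n -> R[i]^o}.
  apply: (@continuous_comp (schwartz R n) (prod_topology T)
    {uniform 'rV[R]_n -> R[i]^o} (@schwartz_jet R n) (@proj _ T bs)).
    exact: initial_continuous.
  exact: proj_continuous.
apply: (cJ [set w : {uniform 'rV[R]_n -> R[i]^o} |
  forall x, rnorm (weighted_partials bs phi x - w x) < e]).
apply/uniform_nbhs; exists [set xy | ball (xy.1 : R[i]^o) e%:C xy.2]; split.
  by rewrite -entourage_ballE; exists e%:C => //=; rewrite ltcR.
move=> w H x; have := H x I; rewrite -ball_normE/= rnormE ltcR.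
exact.
Qed.

Lemma near_sbound phi k m e : 0 < e ->
  \forall psi \near phi, sbound k m (phi - psi : schwartz R n) e.
Proof.
move=> e0; apply: filter_size_le => s _.
pose d := e / (2 ^+ m * (1 + n%:R)).
have c0 : 0 < 2 ^+ m * (1 + n%:R) :> R by rewrite mulr_gt0 ?exprn_gt0// ltr_wpDr.
have d0 : 0 < d by rewrite divr_gt0.
have H : \forall psi \near phi, forall i x,
    rnorm (weighted_partials (coord_power m i, s) phi x -
           weighted_partials (coord_power m i, s) (schwartz_fun psi) x) < d.
  pose A i := [set psi : schwartz R n | forall x,
    rnorm (weighted_partials (coord_power m i, s) phi x -
           weighted_partials (coord_power m i, s) psi x) < d].
  apply: (@filter_forall _ _ A (nbhs phi)) => i.
  have := near_weighted phi (coord_power m i, s) d0.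
  exact: filterS.
apply: filterS2 H (near_weighted phi (no_power, s) d0) => psi H H0 x.
have -> : e = 2 ^+ m * (1 + n%:R) * d by rewrite mulrC divfK// gt_eqF.
have E b y : rnorm (weighted_partials (b, s) phi y - weighted_partials (b, s) psi y) =
    `|monomial b y| * rnorm (partials s (phi - psi : schwartz R n) y).
  rewrite /weighted_partials -mulrBr rnormM rnorm_real.
  by rewrite (partialsB s (schwartz_smooth phi) (schwartz_smooth psi)).
apply: weight_mul_le; first exact: rnorm_ge0.
  by have := H0 x; rewrite E monomial_no_power normr1 mul1r => /ltW.
by move=> i; have := H i x; rewrite E => /ltW.
Qed.

Section functionals.
Context {E : normedModType R[i]}.

(** Otherwise some [phi k] has seminorm of index [k] at most [1 / (k + 1)] and [|f (phi k)| >= 1],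
    although [phi k] tends to 0. The seminorms increase with both indices, so one [k] serves for
    order, decay and constant. *)
Lemma continuous_bounded (f : {linear schwartz R n -> E}) : continuous f ->
  exists k, forall phi M, sbound k k phi M -> rnorm (f phi) <= k.+1%:R * M.
Proof.
move=> cf.
have [k Hk] : exists k, forall phi, sbound k k phi k.+1%:R^-1 -> rnorm (f phi) < 1.
  apply: contrapT => /forallNP H.
  have /choice[phi Hphi] k : exists phi, sbound k k phi k.+1%:R^-1 /\ 1 <= rnorm (f phi).
    have /existsNP[phi /not_implyP[b /negP]] := H k; rewrite -leNgt => f1.
    by exists phi.
  have cphi : phi @ \oo --> (0 : schwartz R n).
    apply: cvg_schwartz => bs e e0.
    pose N := (size bs.2 + \sum_i bs.1 i)%N.
    suff H' : \forall k \near \oo, forall x,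
      rnorm (weighted_partials bs 0 x - weighted_partials bs (phi k) x) < e by exact: H'.
    near=> k => x.
    rewrite {1}/weighted_partials partials0 mulr0 sub0r rnormN rnorm_weighted.
    have Nk : (N <= k)%N by near: k; exact: nbhs_infty_ge.
    apply: (@le_lt_trans _ _ k.+1%:R^-1).
      have := (Hphi k).1 bs.2 (leq_trans (leq_addr _ _) Nk) x; apply: le_trans.
      rewrite ler_wpM2r ?rnorm_ge0// (le_trans (monomial_le _ _))//.
      by rewrite ler_weXn2l ?lerDl// (leq_trans (leq_addl _ _) Nk).
    by near: k; exact: near_infty_natSinv_lt (PosNum e0).
  have := cvg_comp _ _ cphi (cf 0); rewrite linear0.
  move=> /(iffLR (@cvg_rnorm _ E _ _ _ _ _))/(_ 1 ltr01)[N _ /(_ N (leqnn N))] /=.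
  by rewrite sub0r rnormN ltNge (Hphi N).2.
exists k => phi M b; apply/ler_addgt0Pr => e e0.
have M0 := sbound_ge0 b.
(* The summand [e] keeps the divisor positive when [M = 0]. *)
pose c := (k.+1%:R * M + e)^-1.
have c0 : 0 < k.+1%:R * M + e by rewrite ltr_wpDl// mulr_ge0.
have : rnorm (f (c%:C *: phi)) < 1.
  apply: Hk; apply: sbound_le (leqnn k) (leqnn k) _ (sboundZ c b).
  rewrite gtr0_norm ?invr_gt0// /c ler_pdivrMl//.
  by rewrite ler_pdivlMr ?ltr0n// mulrC lerDl ltW.
rewrite linearZ rnormZ gtr0_norm ?invr_gt0// /c ltr_pdivrMl// mulr1.
exact: ltW.
Unshelve. all: by end_near. Qed.

Lemma bounded_continuous (f : {linear schwartz R n -> E}) k m C :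
  (forall phi M, sbound k m phi M -> rnorm (f phi) <= C * M) -> continuous f.
Proof.
move=> fC phi; apply: (iffRL (@cvg_rnorm _ E _ (nbhs phi) _ _ _)) => e e0.
have c0 : 0 < `|C| + 1 by rewrite ltr_wpDl.
have d0 : 0 < e / (`|C| + 1) by rewrite divr_gt0.
apply: filterS (near_sbound phi k m d0) => psi b.
rewrite -linearB (le_lt_trans (fC _ _ b))// mulrCA gtr_pMr// ltr_pdivrMr// mul1r.
by rewrite (le_lt_trans (ler_norm _))// ltrDl.
Qed.

End functionals.

End seminorms.

(** * Limits with a dyadic rate *)

Section nested.
Context {R : realType}.

(** The intervals of radius [2 ^- j] around [a j] are nested from [j0] on, and the supremum of their
    left ends lies in all of them. *)
Lemma nested_limit (a : nat -> R) (j0 : nat) :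
  (forall j, (j0 <= j)%N -> `|a j.+1 - a j| <= 2 ^- j.+1) ->
  exists l, forall j, (j0 <= j)%N -> `|a j - l| <= 2 ^- j.
Proof.
move=> step.
have dist i j : (j0 <= i)%N -> `|a (i + j)%N - a i| <= 2 ^- i - 2 ^- (i + j).
  move=> ji; elim: j => [|j IH]; first by rewrite addn0 !subrr normr0.
  rewrite -(subrK (a (i + j)%N) (a (i + j.+1)%N)) -addrA.
  rewrite (le_trans (ler_normD _ _))// addnS.
  have := step (i + j)%N (leq_trans ji (leq_addr _ _)).
  have : 2 ^- (i + j) = 2 * 2 ^- (i + j).+1 :> R.
    by rewrite exprS invfM mulrA divff ?mul1r.
  by move: IH; lra.
have pos i : 0 < 2 ^- i :> R by rewrite invr_gt0 exprn_gt0.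
have sep i j : (j0 <= i)%N -> (j0 <= j)%N -> a i - 2 ^- i <= a j + 2 ^- j.
  move=> ji jj; have [ij|/ltnW ij] := leqP i j.
    have := dist i (j - i)%N ji; rewrite subnKC// ler_norml => /andP[].
    by have := pos j; lra.
  have := dist j (i - j)%N jj; rewrite subnKC// ler_norml => /andP[].
  by have := pos i; lra.
pose A := [set a i - 2 ^- i | i in [set i | (j0 <= i)%N]].
exists (sup A) => j jj.
have up : sup A <= a j + 2 ^- j.
  apply: sup_le_ub; first by exists (a j0 - 2 ^- j0), j0 => /=.
  by move=> _ [i ji <-]; exact: sep.
have lo : a j - 2 ^- j <= sup A.
  apply: ub_le_sup; last by exists j.
  by exists (a j + 2 ^- j) => _ [i ji <-]; exact: sep.
by rewrite ler_norml; apply/andP; split; lra.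
Qed.

Lemma nested_limit_complex (T : Type) (a : nat -> T -> R[i]) (j0 : nat) :
  (forall j, (j0 <= j)%N -> forall x, rnorm (a j.+1 x - a j x) <= 2 ^- j.+1) ->
  exists l : T -> R[i], forall j, (j0 <= j)%N ->
    forall x, rnorm (a j x - l x) <= 2 * 2 ^- j.
Proof.
move=> step.
have ReE (z w : R[i]) : complex.Re (z - w) = complex.Re z - complex.Re w.
  by case: z w => ? ? [].
have ImE (z w : R[i]) : complex.Im (z - w) = complex.Im z - complex.Im w.
  by case: z w => ? ? [].
have /choice[l1 Hl1] x := @nested_limit (fun j => complex.Re (a j x)) j0
  (fun j jj => le_trans (eq_ind _ (fun z => `|z| <= _) (normRe_le _) _ (ReE _ _))
     (step j jj x)).
have /choice[l2 Hl2] x := @nested_limit (fun j => complex.Im (a j x)) j0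
  (fun j jj => le_trans (eq_ind _ (fun z => `|z| <= _) (normIm_le _) _ (ImE _ _))
     (step j jj x)).
exists (fun x => l1 x +i* l2 x) => j jj x.
apply: (le_trans (rnorm_le_ReIm _)); rewrite ReE ImE mulr_natl mulr2n.
by rewrite lerD// ?Hl1 ?Hl2.
Qed.

End nested.

(** * Equicontinuity on a ball *)

Section gliding_hump.
Context {R : realType} {n : nat} {E : normedModType R[i]}.
Implicit Types (phi psi : schwartz R n) (k m : nat) (M e r : R).

Lemma supported_sbound k m r (u : 'rV[R]_n -> R[i]) M : 0 <= r ->
  supported r u -> sbound k 0 u M -> sbound k m u ((1 + r) ^+ m * M).
Proof.
move=> r0 su b s sk x; have M0 := sbound_ge0 b.
have [xr|rx] := leP `|x| r; last first.
  by rewrite (supported_partials s su rx) rnorm0 mulr0 mulr_ge0// exprn_ge0// addr_ge0.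
rewrite ler_pM ?weight_ge0 ?rnorm_ge0//; last exact: sbound_partials b sk.
by rewrite lerXn2r ?nnegrE ?addr_ge0// lerD2l.
Qed.

Lemma sboundD k m phi psi M M' : sbound k m phi M -> sbound k m psi M' ->
  sbound k m (phi + psi : schwartz R n) (M + M').
Proof.
move=> b b' s sk x.
have -> : (phi + psi : schwartz R n) = (1 : R[i]) *: (phi : 'rV[R]_n -> R[i]) + psi
  :> ('rV[R]_n -> R[i]) by rewrite scale1r.
rewrite partials_lin; [|exact: schwartz_smooth..].
rewrite scale1r (le_trans (ler_wpM2l (weight_ge0 _ _) (rnormD _ _)))//.
by rewrite mulrDr lerD ?b ?b'.
Qed.

(** Completeness of the functions supported in a ball. Step [j] controls the derivatives of order at
    most [j], so the derivative [s] converges uniformly along the steps from [size s] on. *)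
Lemma schwartz_limit (u : nat -> schwartz R n) r :
  (forall j, supported r (u j)) ->
  (forall j, sbound j 0 (u j.+1 - u j : schwartz R n) (2 ^- j.+1)) ->
  exists2 phi : schwartz R n, supported r phi &
    forall s x e, 0 < e -> exists N0, forall N, (N0 <= N)%N ->
      rnorm (partials s (phi - u N : schwartz R n) x) <= e.
Proof.
move=> su bu.
have dpart s (v w : schwartz R n) x : partials s (v - w : schwartz R n) x =
    partials s v x - partials s w x.
  by rewrite (partialsB s (schwartz_smooth v) (schwartz_smooth w)).
have /choice[F HF] s : exists l : 'rV[R]_n -> R[i], forall j, (size s <= j)%N ->
    forall x, rnorm (partials s (u j) x - l x) <= 2 * 2 ^- j.
  apply: nested_limit_complex => j sj x; have := bu j s sj x.
  by rewrite expr0 mul1r dpart.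
have uF s e : 0 < e -> exists N0, forall N, (N0 <= N)%N ->
    forall x, rnorm (partials s (u N) x - F s x) <= e.
  move=> e0; have e20 : 0 < e / 2 by rewrite divr_gt0.
  have [N1 _ HN1] := near_infty_natSinv_lt (PosNum e20).
  exists (maxn N1 (size s)) => N; rewrite geq_max => /andP[N1N sN] x.
  apply: (le_trans (HF s N sN x)).
  rewrite mulrC -ler_pdivlMr//; apply: le_trans (ltW (HN1 N N1N)).
  by rewrite lef_pV2 ?posrE ?exprn_gt0 ?ltr0n// -natrX ler_nat ltn_expl.
have [sF FE] := smooth_limit (fun N => schwartz_smooth (u N)) uF.
have sup : supported r (F [::]).
  move=> x rx; apply: rnorm_eq0; apply/eqP; rewrite eq_le rnorm_ge0 andbT.
  apply/ler_addgt0Pr => e e0; rewrite add0r.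
  have [N0 /(_ _ (leqnn _))/(_ x)] := uF [::] e e0.
  by rewrite /= su// sub0r rnormN.
have tF : F [::] \in testfun_pred by apply/asboolP; split=> //; exact: compact_supp sup.
exists (Schwartz (testfun_pred_schwartz tF)) => // s x e /(uF s)[N0 HN0].
exists N0 => N /HN0/(_ x); rewrite dpart -rnormN opprB.
by rewrite [partials s (Schwartz _)]FE.
Qed.

Lemma sbound_limit k m phi (u : nat -> schwartz R n) (j : nat) M :
  (forall s x e, 0 < e -> exists N0, forall N, (N0 <= N)%N ->
     rnorm (partials s (phi - u N : schwartz R n) x) <= e) ->
  (forall N, (j <= N)%N -> sbound k m (u N - u j : schwartz R n) M) ->
  sbound k m (phi - u j : schwartz R n) M.
Proof.
move=> cu bu s sk x; apply/ler_addgt0Pr => e e0.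
have w0 : 0 < (1 + `|x|) ^+ m by rewrite exprn_gt0// ltr_wpDr.
have [N0 HN0] := cu s x _ (divr_gt0 e0 w0).
have := HN0 (maxn N0 j) (leq_maxl _ _); have := bu (maxn N0 j) (leq_maxr _ _) s sk x.
set N := maxn _ _.
have -> : partials s (phi - u j : schwartz R n) x =
    partials s (phi - u N : schwartz R n) x + partials s (u N - u j : schwartz R n) x.
  rewrite !(partialsB s (schwartz_smooth _) (schwartz_smooth _)) !fctE.
  by rewrite addrA subrK.
rewrite ler_pdivlMr// => b1 b2.
apply: (le_trans (ler_wpM2l (ltW w0) (rnormD _ _))).
by rewrite mulrDr addrC lerD// mulrC.
Qed.

Variables (I : Type) (T : I -> schwartz R n -> E) (Lam : nat -> set I) (r : R).
Hypothesis r0 : 0 <= r.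
Hypothesis Lam_decr : forall N N', (N <= N')%N -> Lam N' `<=` Lam N.
Hypothesis TD : forall l, Lam 0%N l -> {morph T l : phi psi / phi + psi}.
Hypothesis TZ : forall l (c : R) phi, Lam 0%N l -> T l (c%:C *: phi) = c%:C *: T l phi.
Hypothesis T_bounded : forall l, Lam 0%N l -> exists k C,
  forall phi M, sbound k k phi M -> rnorm (T l phi) <= C * M.
Hypothesis T_pointwise : forall phi, supported r phi -> exists N B,
  forall l, Lam N l -> rnorm (T l phi) <= B.

(** A violation of the bound, scaled to the value [A], becomes a function as small as desired in any
    given seminorm. *)
Lemma hump_exists :
  ~ (exists k C, 0 <= C /\ forall l, Lam k l -> forall phi M, supported r phi ->
     sbound k 0 phi M -> rnorm (T l phi) <= C * M) ->
  forall N k d A, 0 < d -> 0 < A -> exists l phi,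
    [/\ Lam N l, supported r phi, sbound k k phi d & A <= rnorm (T l phi)].
Proof.
move=> H N k d A d0 A0.
have r10 : 0 < (1 + r) ^+ k by rewrite exprn_gt0// ltr_wpDr.
(* Chosen so that the scaled function has seminorm at most [d]; [(1 + r) ^ k] bounds the weight on
   the ball. *)
pose C := A * (1 + r) ^+ k / d.
have C0 : 0 <= C by rewrite divr_ge0 ?ltW// mulr_gt0.
move/forallNP/(_ (maxn N k))/forallNP/(_ C)/not_andP : H => [//|].
move=> /existsNP[l /not_implyP[Ll /existsNP[phi /existsNP[M]]]].
move=> /not_implyP[sphi /not_implyP[b /negP]]; rewrite -ltNge => big.
have M0 := sbound_ge0 b.
have t0 : 0 < rnorm (T l phi) by rewrite (le_lt_trans _ big)// mulr_ge0.
pose c := A / rnorm (T l phi); have c0 : 0 < c by rewrite divr_gt0.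
have scphi : supported r (c%:C *: phi : schwartz R n).
  by move=> x rx; rewrite -[LHS]/(c%:C * phi x) sphi ?mulr0.
exists l, (c%:C *: phi); split=> //.
- exact: Lam_decr (leq_maxl _ _) _ Ll.
- have := supported_sbound k r0 scphi
    (sbound_le (leq_maxr N k) (leqnn 0) (lexx _) (sboundZ c b)).
  apply: sbound_le => //; rewrite gtr0_norm// /c.
  rewrite [leLHS](_ : _ = C * M / rnorm (T l phi) * d); last first.
    by rewrite /C; field; rewrite !gt_eqF.
  by rewrite ler_piMl ?(ltW d0)// ler_pdivrMr// mul1r ltW.
- rewrite TZ; last exact: Lam_decr (leq0n _) _ Ll.
  by rewrite rnormZ gtr0_norm// /c divfK// gt_eqF.
Qed.

(** A stage of the construction: the sum of the humps so far, with an order and a tolerance that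
    later humps must respect. *)
Let state := {st : schwartz R n * nat * R | supported r st.1.1 /\ 0 < st.2}.
Let fn (st : state) := (sval st).1.1.
Let ord (st : state) := (sval st).1.2.
Let eps (st : state) := (sval st).2.

(** The norm of [T l] for the seminorm recorded in the stage is at most [1 / eps st], so humps that
    respect the stage barely change [T l]. *)
Let tame l (st : state) := forall phi e, 0 <= e ->
  sbound (ord st) (ord st) phi (eps st * e) -> rnorm (T l phi) <= e.

(** The new hump is small for the recorded seminorm, which protects the functionals already chosen,
    and for order [j], which makes the sum converge. *)
Let next (js : nat * state) (st : state) := [/\
  (ord js.2 <= ord st)%N, eps st <= eps js.2,
  sbound (maxn js.1 (ord js.2)) (maxn js.1 (ord js.2)) (fn st - fn js.2 : schwartz R n)
    (eps js.2 * 2 ^- js.1.+1) &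
  exists l, [/\ Lam js.1 l, js.1.+1%:R <= rnorm (T l (fn st)) & tame l st]].

(** Were this false, the humps would sum to some [phi] supported in the ball. The functional chosen
    at stage [j] is at least [j.+1] on the partial sum it sees, and all later humps change it by at
    most 1, against the bound for [phi]. *)
Lemma banach_steinhaus : exists k C, 0 <= C /\ forall l, Lam k l ->
  forall phi M, supported r phi -> sbound k 0 phi M -> rnorm (T l phi) <= C * M.
Proof.
apply: contrapT => /hump_exists hump.
have /choice[f Hf] js : exists st, next js st.
  case: js => j st; have [sst e0] := svalP st.
  have [N0 [B HB]] := T_pointwise sst.
  have p0 : 0 < eps st * 2 ^- j.+1 by rewrite mulr_gt0 ?invr_gt0 ?exprn_gt0.
  (* [B] bounds [T l] on the current sum for [l] in [Lam N0]; the hump must exceed it by [j.+1]. *)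
  have A0 : 0 < j.+1%:R + `|B| :> R by rewrite ltr_wpDr.
  have [l [phi [Ll sphi b big]]] := hump (maxn j N0) (maxn j (ord st)) _ _ p0 A0.
  have Ll0 := Lam_decr (leq0n _) Ll.
  have [k [C HC]] := T_bounded Ll0.
  have C0 : 0 < `|C| + 1 by rewrite ltr_wpDl.
  (* The order is raised and the tolerance lowered until they control the functional [T l] just
     chosen. *)
  pose st' := (fn st + phi, maxn (ord st) k, Num.min (eps st) (`|C| + 1)^-1).
  have Hst' : supported r st'.1.1 /\ 0 < st'.2.
    split; last by rewrite lt_min e0 invr_gt0.
    by move=> x rx; rewrite -[LHS]/(fn st x + phi x) sst// sphi// addr0.
  exists (exist _ st' Hst'); split=> /=.
  - exact: leq_maxl.
  - by rewrite /eps /= ge_min lexx.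
  - by rewrite /fn /= addrC addKr.
  exists l; split; first exact: Lam_decr (leq_maxl _ _) _ Ll.
    rewrite /fn /= TD//.
    have := HB l (Lam_decr (leq_maxr _ _) Ll); have := ler_norm B.
    have := rnormB (T l (fn st) + T l phi) (T l (fn st)).
    by rewrite addrC addKr; move: big; rewrite /fn; lra.
  move=> psi e e_ge0 b'; apply: (@le_trans _ _ (C * ((`|C| + 1)^-1 * e))).
    apply: HC; apply: sbound_le b'; [exact: leq_maxr|exact: leq_maxr|].
    by rewrite ler_wpM2r// /eps /= ge_min lexx orbT.
  rewrite mulrA ler_piMl// ler_pdivrMr// mul1r.
  by rewrite (le_trans (ler_norm _))// lerDl.
have H0 : supported r (0 : schwartz R n, 0%N, 1 : R).1.1 /\ 0 < (0 : schwartz R n, 0%N, 1 : R).2.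
  by split=> [x _|]; [|exact: ltr01].
pose st := fix st j : state :=
  if j is j'.+1 then f (j', st j') else exist _ (0, 0%N, 1) H0.
pose u j := fn (st j).
have Hst j : next (j, st j) (st j.+1) := Hf (j, st j).
have mono i j : (i <= j)%N -> (ord (st i) <= ord (st j))%N /\ eps (st j) <= eps (st i).
  move=> ij; rewrite -(subnK ij) addnC; elim: (j - i)%N => [|k [IH1 IH2]].
    by rewrite addn0.
  rewrite addnS; have [h1 h2 _ _] := Hst (i + k)%N.
  by split; [exact: leq_trans IH1 h1|exact: le_trans h2 IH2].
have eps0 j : 0 < eps (st j) by have [] := svalP (st j).
have eps1 j : eps (st j) <= 1 by have [_] := mono 0%N j (leq0n j).
have p0 j : 0 < 2 ^- j :> R by rewrite invr_gt0 exprn_gt0.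
have [||phi sphi cphi] := @schwartz_limit u r.
- by move=> j; have [] := svalP (st j).
- move=> j; have [_ _ b _] := Hst j.
  apply: sbound_le b; [exact: leq_maxl|exact: leq0n|].
  by rewrite ler_piMl ?(ltW (p0 _))//=; exact: eps1.
(* Orders only grow and tolerances only shrink, so in the seminorm of stage [j] the later humps are
   dominated by a geometric series. *)
have tail j N : (j <= N)%N ->
    sbound (ord (st j)) (ord (st j)) (u N - u j : schwartz R n)
      (eps (st j) * (2 ^- j - 2 ^- N)).
  move=> jN; rewrite -(subnK jN) addnC; elim: (N - j)%N => [|k IH].
    rewrite addn0 !subrr mulr0 => s _ x.
    by rewrite [(0 : schwartz R n) : _ -> _](_ : _ = 0)// partials0 rnorm0 mulr0.
  have [_ _ b _] := Hst (j + k)%N; have [h1 h2] := mono j (j + k)%N (leq_addr _ _).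
  have {}b : sbound (ord (st j)) (ord (st j)) (u (j + k).+1 - u (j + k)%N : schwartz R n)
      (eps (st j) * 2 ^- (j + k).+1).
    apply: sbound_le b; rewrite ?(leq_trans h1) ?leq_maxr//.
    by rewrite ler_wpM2r// ltW.
  have := sboundD b IH; rewrite addrA subrK addnS -mulrDr.
  rewrite (_ : 2 ^- (j + k).+1 + _ = 2 ^- j - 2 ^- (j + k).+1)//.
  have -> : 2 ^- (j + k) = 2 * 2 ^- (j + k).+1 :> R.
    by rewrite exprS invfM mulrA divff ?mul1r.
  by ring.
have [N [B HB]] := T_pointwise sphi.
(* Puts [l] into [Lam N] and makes [j.+1] exceed [|B| + 1], where the 1 accounts for the tail. *)
pose j := maxn N (Num.truncn `|B|).+1.
have [_ _ _ [l [Ll big tm]]] := Hst j.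
have : rnorm (T l (phi - u j.+1)) <= 1.
  apply: (le_trans (y := 2 ^- j.+1)); last first.
    by rewrite invf_le1 ?exprn_gt0// exprn_ege1// ler1n.
  apply: tm; first exact: ltW.
  apply: sbound_limit cphi _ => i ji.
  by apply: sbound_le (tail _ _ ji) => //; rewrite ler_wpM2l ?(ltW (eps0 _))// gerBl ltW.
have Ll0 := Lam_decr (leq0n _) Ll.
have := HB l (Lam_decr (leq_maxl _ _) Ll).
have := rnormB (T l phi) (T l (phi - u j.+1)).
have -> : T l phi - T l (phi - u j.+1) = T l (u j.+1).
  by apply/eqP; rewrite subr_eq -TD// addrC subrK.
have : `|B| + 1 < j.+1%:R.
  rewrite -natr1 ltrD2r (lt_le_trans (truncnS_gt _))//.
  by rewrite ler_nat leq_maxr.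
by have := ler_norm B; rewrite /u; lra.
Qed.

End gliding_hump.

(** * Dyadic decomposition *)

Section cut.
Context {R : realType} {n : nat}.
Implicit Types (phi psi : schwartz R n) (k m q : nat) (M a l : R)
  (x : 'rV[R]_n) (s : seq 'I_n).

Lemma schwartz_dilateD l : l != 0 ->
  {morph @schwartz_dilate R n l : phi psi / phi + psi}.
Proof.
move=> l0 phi psi; apply/val_inj/funext => x.
rewrite [LHS]schwartz_dilateE// -[RHS]/(schwartz_dilate l phi x + schwartz_dilate l psi x).
by rewrite !schwartz_dilateE.
Qed.

Lemma schwartz_dilateZ l (c : R[i]) phi : l != 0 ->
  schwartz_dilate l (c *: phi) = c *: schwartz_dilate l phi.
Proof.
move=> l0; apply/val_inj/funext => x.
rewrite [LHS]schwartz_dilateE// -[RHS]/(c *: (schwartz_dilate l phi x : R[i]^o)).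
by rewrite schwartz_dilateE.
Qed.

Lemma schwartz_dilateM a l phi : a != 0 -> l != 0 ->
  schwartz_dilate l (schwartz_dilate a phi) = schwartz_dilate (l * a) phi.
Proof.
move=> a0 l0; apply/val_inj/funext => x.
rewrite [LHS]schwartz_dilateE// [LHS]schwartz_dilateE// [RHS]schwartz_dilateE ?mulf_neq0//.
by rewrite scalerA invfM mulrC.
Qed.

Lemma schwartz_dilate1 phi : schwartz_dilate 1 phi = phi.
Proof.
apply/val_inj/funext => x.
by rewrite [LHS]schwartz_dilateE ?oner_neq0// invr1 scale1r.
Qed.

Lemma partials_schwartz_dilate l phi s x : 0 < l ->
  rnorm (partials s (schwartz_dilate l phi) x) =
  l ^- size s * rnorm (partials s phi (l^-1 *: x)).
Proof.
move=> l0; have l0' : l != 0 by rewrite gt_eqF.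
have -> : schwartz_dilate l phi = dilate_fun l phi :> ('rV[R]_n -> R[i]).
  by apply/funext => y; rewrite schwartz_dilateE.
rewrite (partials_dilate _ l0' (schwartz_smooth phi)) rnormM rnorm_real.
by rewrite ger0_norm// invr_ge0 exprn_ge0// ltW.
Qed.

(** Each derivative costs [1 / l], and [1 + |x| <= (1 + l) * (1 + |x / l|)] transfers the weight. *)
Lemma sbound_dilate k m l phi M : 0 < l -> sbound k m phi M ->
  sbound k m (schwartz_dilate l phi) ((1 + l^-1) ^+ k * (1 + l) ^+ m * M).
Proof.
move=> l0 b s sk x; have li0 : 0 < l^-1 by rewrite invr_gt0.
rewrite partials_schwartz_dilate// mulrCA -mulrA.
apply: ler_pM; rewrite ?invr_ge0 ?exprn_ge0 ?(ltW l0)//.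
- by rewrite mulr_ge0 ?weight_ge0 ?rnorm_ge0.
- rewrite -exprVn (@le_trans _ _ ((1 + l^-1) ^+ size s))//.
    by rewrite lerXn2r ?nnegrE ?addr_ge0 ?(ltW li0)// lerDr.
  by rewrite ler_weXn2l// lerDl ltW.
have w0 : 0 <= 1 + l by rewrite addr_ge0// ltW.
have H : (1 + `|x|) ^+ m <= (1 + l) ^+ m * (1 + `|l^-1 *: x|) ^+ m.
  rewrite -exprMn lerXn2r ?nnegrE ?addr_ge0 ?mulr_ge0 ?addr_ge0 ?(ltW l0)//.
  rewrite normrZ gtr0_norm// mulrDl mul1r mulrDr mulr1.
  rewrite mulrA divff ?gt_eqF// mul1r.
  have : 0 <= l^-1 * `|x| by rewrite mulr_ge0// ltW.
  by move: l0 (normr_ge0 x); lra.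
apply: (le_trans (ler_wpM2r (rnorm_ge0 _) H)); rewrite -mulrA.
by rewrite ler_wpM2l ?exprn_ge0//; exact: b.
Qed.

Lemma partials_cst i s (c : R[i]) x : partials (i :: s) (fun=> c) x = 0.
Proof.
have partial_cst j (z : R[i]) : partial j ((fun=> z) : 'rV[R]_n -> R[i]) = fun=> 0.
  apply/funext => y; rewrite /partial.
  by rewrite (derive_cst (complex.Re z)) (derive_cst (complex.Im z)).
have [z E] : exists z, partials s ((fun=> c) : 'rV[R]_n -> R[i]) = fun=> z.
  by elim: s => [|j s [z E]] /=; [exists c|exists 0; rewrite E partial_cst].
by rewrite /= E partial_cst.
Qed.

Lemma partials_near0 (u : 'rV[R]_n -> R[i]) a s x :
  (forall y, `|y| < a -> u y = 0) -> `|x| < a -> partials s u x = 0.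
Proof.
move=> u0 xa; apply: partials_supp; rewrite /supp => /(_ [set y | `|y| < a]).
case=> [|y [/= uy /u0 y0]]; last by rewrite y0 eqxx in uy.
apply: open_nbhs_nbhs; split=> //.
apply: (@open_comp _ _ (fun y : 'rV[R]_n => `|y|) [set z | z < a]); last exact: open_lt.
by move=> y _; exact: norm_continuous.
Qed.

Definition cutoffC x : R[i] := (cutoff x)%:C.

Lemma smooth_cutoffC : smooth cutoffC.
Proof. by apply: smooth_elementary; exact: elementary_cutoff. Qed.

(** Dilation by [a >= 1] multiplies a derivative of order [j] by [a ^- j <= 1], so one bound serves
    all [a]. *)
Lemma cutoffC_bounded k : exists2 A, 1 <= A &
  forall a s x, 1 <= a -> (size s <= k)%N ->
  rnorm (partials s (dilate_fun a cutoffC) x) <= A.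
Proof.
have [A b] := schwartz_sbound k 0 (Schwartz (testfun_pred_schwartz (@testfun_cutoff R n))).
exists (`|A| + 1); first by rewrite lerDr.
move=> a s x a1 sk; have a0 : a != 0 by rewrite gt_eqF// (lt_le_trans ltr01).
rewrite (partials_dilate _ a0 smooth_cutoffC) rnormM rnorm_real.
have ai : `|a ^- size s| <= 1.
  rewrite ger0_norm ?invr_ge0 ?exprn_ge0 ?(le_trans ler01)//.
  by rewrite invf_le1 ?exprn_gt0 ?exprn_ege1// (lt_le_trans ltr01).
apply: (@le_trans _ _ (1 * A)); last by rewrite mul1r (le_trans (ler_norm A))// lerDl.
apply: ler_pM => //; first exact: rnorm_ge0.
by have := b s sk (a^-1 *: x); rewrite expr0 mul1r.
Qed.

Lemma cut_testfun a phi : 0 < a ->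
  (fun x => dilate_fun a cutoffC x * phi x) \in testfun_pred.
Proof.
move=> a0; apply/asboolP; split.
  apply: smoothM; last exact: schwartz_smooth.
  by apply: smooth_dilate smooth_cutoffC; rewrite gt_eqF.
apply: (@compact_supp _ _ (2 * a)) => x ax.
rewrite /dilate_fun /cutoffC cutoff0 ?mul0r// normrZ normfV gtr0_norm//.
by rewrite ler_pdivlMl// mulrC ltW.
Qed.

(** The default [0] of [insubd] is not reached when [0 < a]. *)
Definition cut a phi : testfun R n :=
  insubd (0 : testfun R n) (fun x => dilate_fun a cutoffC x * phi x).

Lemma cutE a phi : 0 < a -> cut a phi = (fun x => dilate_fun a cutoffC x * phi x) :> (_ -> _).
Proof. by move=> a0; rewrite /cut val_insubd cut_testfun. Qed.

Notation cutS a phi := (testfun_schwartz (cut a phi)).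

Lemma cut_sbound k : exists2 A, 0 <= A & forall phi M,
  sbound k 0 phi M -> sbound k 0 (cutS 1 phi) (A * M).
Proof.
have [A A1 HA] := cutoffC_bounded k.
have A0 : 0 <= A by rewrite (le_trans ler01).
exists (2 ^+ k * A); first by rewrite mulr_ge0// exprn_ge0.
move=> phi M b s sk x; have M0 := sbound_ge0 b.
rewrite expr0 mul1r [X in partials s X](cutE phi ltr01).
have s1 : smooth (dilate_fun 1 cutoffC) by exact: smooth_dilate smooth_cutoffC.
apply: (le_trans (partialsM_le (A := A) (B := M) s1 (schwartz_smooth phi) _ _)).
- by move=> t ts; apply: HA => //; exact: leq_trans ts sk.
- by move=> t ts; apply: sbound_partials b (leq_trans ts sk).
by rewrite mulrA ler_wpM2r// ler_wpM2r// ler_weXn2l// ler1n.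
Qed.

(** The difference vanishes for [|x| < a], and elsewhere the [q] spare powers of the weight gain
    [a ^- q]. This is the density of test functions, with a rate. *)
Lemma cut_tail k m q : exists2 A, 0 <= A & forall a phi M, 1 <= a ->
  sbound k (m + q) phi M -> sbound k m (phi - cutS a phi : schwartz R n) (A * a ^- q * M).
Proof.
have [A A1 HA] := cutoffC_bounded k.
exists (2 ^+ k * (1 + A)); first by rewrite mulr_ge0 ?exprn_ge0 ?addr_ge0// (le_trans ler01).
move=> a phi M a1 b s sk x; have M0 := sbound_ge0 b.
have a0 : 0 < a by rewrite (lt_le_trans ltr01).
pose one : 'rV[R]_n -> R[i] := fun=> 1.
have s1 : smooth one.
  have := @smooth_elementary R n _ (elementary_cst 1); exact.
have sa : smooth (dilate_fun a cutoffC).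
  by apply: smooth_dilate smooth_cutoffC; rewrite gt_eqF.
pose chi : 'rV[R]_n -> R[i] := one - dilate_fun a cutoffC.
have schi : smooth chi by rewrite /chi addrC -scaleN1r; exact: smooth_lin.
have -> : (phi - cutS a phi : schwartz R n) = (fun x => chi x * phi x) :> (_ -> _).
  apply/funext => y; rewrite -[LHS]/(phi y - cut a phi y) cutE//.
  by rewrite /chi mulrBl mul1r.
have K0 : 0 <= 2 ^+ k * (1 + A) * a ^- q * M.
  by rewrite !mulr_ge0 ?exprn_ge0 ?addr_ge0 ?invr_ge0 ?exprn_ge0 ?(ltW a0)// (le_trans ler01).
have [xa|ax] := ltP `|x| a.
  rewrite (@partials_near0 _ a)// ?rnorm0 ?mulr0// => y ya.
  rewrite /chi !fctE /one /dilate_fun /cutoffC cutoff1 ?subrr ?mul0r//.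
  by rewrite normrZ normfV gtr0_norm// ler_pdivrMl// mulr1 ltW.
have w0 j : 0 < (1 + `|x|) ^+ j by rewrite exprn_gt0// ltr_wpDr.
have P : rnorm (partials s (fun x => chi x * phi x) x) <=
    2 ^+ size s * ((1 + A) * (M / (1 + `|x|) ^+ (m + q))).
  apply: (partialsM_le schi (schwartz_smooth phi)).
    move=> t ts; rewrite (partialsB t s1 sa) (le_trans (rnormB _ _))// lerD//.
      case: t ts => [|i t] _; first by rewrite rnorm_real normr1.
      by rewrite partials_cst rnorm0.
    by apply: HA => //; exact: leq_trans ts sk.
  move=> t ts; rewrite ler_pdivlMr// mulrC; apply: b; exact: leq_trans ts sk.
apply: (le_trans (ler_wpM2l (ltW (w0 m)) P)).
rewrite [leLHS](_ : _ = 2 ^+ size s * (1 + A) * (1 + `|x|) ^- q * M); last first.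
  by rewrite exprD; field; rewrite !gt_eqF.
rewrite ler_wpM2r//; apply: ler_pM.
- by rewrite mulr_ge0 ?exprn_ge0 ?addr_ge0// (le_trans ler01).
- by rewrite invr_ge0 ltW.
- by rewrite ler_wpM2r ?addr_ge0 ?(le_trans ler01)// ler_weXn2l// ler1n.
rewrite lef_pV2 ?posrE ?exprn_gt0// lerXn2r ?nnegrE ?addr_ge0 ?(ltW a0)//.
by rewrite (le_trans ax)// lerDr.
Qed.

(** The part of [phi] on [a <= |x| <= 4 * a], brought back to the fixed region [1 <= |x| <= 4]. *)
Definition block a phi : schwartz R n :=
  schwartz_dilate a^-1 (cutS (2 * a) phi - cutS a phi).

Lemma block_dilate a phi : 0 < a ->
  schwartz_dilate a (block a phi) = cutS (2 * a) phi - cutS a phi.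
Proof.
move=> a0; rewrite /block schwartz_dilateM ?invr_eq0 ?gt_eqF// divff ?gt_eqF//.
exact: schwartz_dilate1.
Qed.

(** In this form the cutoff factor does not depend on [a], so its derivatives are bounded once and
    for all. *)
Lemma blockE a phi : 0 < a -> block a phi =
  (fun x => (dilate_fun 2 cutoffC - dilate_fun 1 cutoffC) x *
     schwartz_dilate a^-1 phi x) :> (_ -> _).
Proof.
move=> a0; have ai0 : a^-1 != 0 by rewrite invr_eq0 gt_eqF.
apply/funext => x.
rewrite -[RHS]/((dilate_fun 2 cutoffC x - dilate_fun 1 cutoffC x) *
  schwartz_dilate a^-1 phi x) (schwartz_dilateE phi x ai0).
rewrite /block (schwartz_dilateE _ x ai0) invrK.
have a20 : 0 < 2 * a by rewrite mulr_gt0.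
have E : (cutS (2 * a) phi - cutS a phi : schwartz R n) (a *: x) =
    cut (2 * a) phi (a *: x) - cut a phi (a *: x) by [].
rewrite E [X in X - _](congr1 (@^~ (a *: x)) (cutE phi a20)).
rewrite [X in _ - X](congr1 (@^~ (a *: x)) (cutE phi a0)).
have an : a != 0 by rewrite gt_eqF.
have E2 : dilate_fun (2 * a) cutoffC (a *: x) = dilate_fun 2 cutoffC x.
  by rewrite /dilate_fun scalerA invfM -mulrA (mulVf an) mulr1.
have E1 : dilate_fun a cutoffC (a *: x) = dilate_fun 1 cutoffC x.
  have ex : a^-1 *: (a *: x) = 1^-1 *: x by rewrite scalerA (mulVf an) invr1.
  exact: (congr1 cutoffC ex).
rewrite -mulrBl.
have H := congr2 (fun p q : R[i] => (p - q) * phi (a *: x)) E2 E1.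
exact H.
Qed.

Lemma dilate_cutoffC1 a x : 0 < a -> `|x| <= a -> dilate_fun a cutoffC x = 1.
Proof.
move=> a0 xa; rewrite /dilate_fun /cutoffC cutoff1//.
by rewrite normrZ normfV gtr0_norm// ler_pdivrMl// mulr1.
Qed.

Lemma dilate_cutoffC0 a x : 0 < a -> 2 * a <= `|x| -> dilate_fun a cutoffC x = 0.
Proof.
move=> a0 xa; rewrite /dilate_fun /cutoffC cutoff0//.
by rewrite normrZ normfV gtr0_norm// ler_pdivlMl// mulrC.
Qed.

Lemma block_supported a phi : 0 < a -> supported 4 (block a phi).
Proof.
move=> a0 x x4; rewrite blockE//.
have E2 : dilate_fun 2 cutoffC x = 0 by apply: dilate_cutoffC0 => //; lra.
have E1 : dilate_fun 1 cutoffC x = 0 by apply: dilate_cutoffC0 => //; lra.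
rewrite (congr2 (fun p q : R[i] => (p - q) * schwartz_dilate a^-1 phi x) E2 E1).
by rewrite subrr mul0r.
Qed.

(** Derivatives of [phi (a x)] cost at most [a ^ k], while for [|x| >= 1] the decay of order [k + m]
    gains [a ^- (k + m)]. *)
Lemma block_sbound k m : exists2 A, 0 <= A & forall a phi M, 1 <= a ->
  sbound k (k + m) phi M -> sbound k 0 (block a phi) (A * a ^- m * M).
Proof.
have [A A1 HA] := cutoffC_bounded k.
have A0 : 0 <= A by rewrite (le_trans ler01).
exists (2 ^+ k * (A + A)); first by rewrite mulr_ge0 ?exprn_ge0 ?addr_ge0.
move=> a phi M a1 b s sk x; have M0 := sbound_ge0 b.
have a0 : 0 < a by rewrite (lt_le_trans ltr01).
have s1 : smooth (dilate_fun 1 cutoffC) by exact: smooth_dilate smooth_cutoffC.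
have s2 : smooth (dilate_fun 2 cutoffC) by exact: smooth_dilate smooth_cutoffC.
rewrite expr0 mul1r blockE//.
set theta := _ - _.
have st : smooth theta by rewrite /theta addrC -scaleN1r; exact: smooth_lin.
have K0 : 0 <= 2 ^+ k * (A + A) * a ^- m * M.
  by rewrite !mulr_ge0 ?exprn_ge0 ?addr_ge0 ?invr_ge0 ?exprn_ge0 ?(ltW a0).
have [x1|x1] := ltP `|x| 1.
  rewrite (@partials_near0 _ 1)// ?rnorm0// => y y1.
  have E2 : dilate_fun 2 cutoffC y = 1 by apply: dilate_cutoffC1 => //; lra.
  have E1 : dilate_fun 1 cutoffC y = 1 by apply: dilate_cutoffC1 => //; exact: ltW.
  rewrite (congr2 (fun p q : R[i] => (p - q) * schwartz_dilate a^-1 phi y) E2 E1).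
  by rewrite subrr mul0r.
have P : rnorm (partials s (fun x => theta x * schwartz_dilate a^-1 phi x) x) <=
    2 ^+ size s * ((A + A) * (a ^- m * M)).
  apply: (partialsM_le st (schwartz_smooth _)).
    move=> t ts; have tk := leq_trans ts sk.
    rewrite (partialsB t s2 s1) (le_trans (rnormB _ _))// lerD//.
      by apply: HA => //; lra.
    by apply: HA.
  move=> t ts; have tk := leq_trans ts sk.
  rewrite partials_schwartz_dilate ?invr_gt0// invrK exprVn invrK.
  have w1 : a ^+ (k + m) <= (1 + `|a *: x|) ^+ (k + m).
    rewrite lerXn2r ?nnegrE ?addr_ge0 ?(ltW a0)// normrZ gtr0_norm//.
    by rewrite (@le_trans _ _ (a * `|x|)) ?ler_peMr ?lerDr ?(ltW a0).
  have := le_trans (ler_wpM2r (rnorm_ge0 _) w1) (b t tk (a *: x)).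
  rewrite -ler_pdivlMl ?exprn_gt0// => H.
  apply: (le_trans (ler_wpM2l _ H)); first by rewrite exprn_ge0// ltW.
  rewrite mulrA ler_wpM2r// ler_pdivrMr ?exprn_gt0// exprD mulrCA mulVf ?mulr1.
    exact: ler_weXn2l.
  by rewrite expf_neq0// gt_eqF.
apply: (le_trans P); rewrite !mulrA ler_wpM2r// ler_wpM2r ?invr_ge0 ?exprn_ge0 ?(ltW a0)//.
by rewrite ler_wpM2r ?addr_ge0// ler_weXn2l// ler1n.
Qed.

End cut.

(** * Equicontinuity on the Schwartz space *)

Section uniform_bound.
Context {R : realType} {n : nat} {E : normedModType R[i]}.
Variables (f : {linear schwartz R n -> E}) (rho : R -> R).
Implicit Types (phi psi : schwartz R n) (k m q : nat) (M C l a : R).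

Notation cutS a phi := (testfun_schwartz (cut a phi)).

(** The weight [rho] stays abstract; its instance [gauge] gives the quasiasymptotic quotient. *)
Definition rescaled l phi : E := (rho l)%:C *: f (schwartz_dilate l phi).

Lemma rescaledD l : l != 0 -> {morph rescaled l : phi psi / phi + psi}.
Proof.
by move=> l0 phi psi; rewrite /rescaled schwartz_dilateD// linearD scalerDr.
Qed.

Lemma rescaledZ l (c : R[i]) phi : l != 0 -> rescaled l (c *: phi) = c *: rescaled l phi.
Proof.
by move=> l0; rewrite /rescaled schwartz_dilateZ// linearZ !scalerA mulrC.
Qed.

Lemma rescaledB l phi psi : l != 0 -> rescaled l (phi - psi) = rescaled l phi - rescaled l psi.
Proof.
by move=> l0; rewrite rescaledD// -[- psi]scaleN1r rescaledZ// scaleN1r.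
Qed.

Lemma rescaled_dilate l a phi (b : R) : l != 0 -> a != 0 ->
  0 <= rho l <= b * rho (l * a) -> 0 <= b ->
  rnorm (rescaled l (schwartz_dilate a phi)) <= b * rnorm (rescaled (l * a) phi).
Proof.
move=> l0 a0 /andP[r0 rb] b0; rewrite /rescaled schwartz_dilateM// !rnormZ mulrA.
rewrite ler_wpM2r ?rnorm_ge0// ger0_norm// (le_trans rb)//.
by rewrite ler_wpM2l// ler_norm.
Qed.

Lemma rescaled_bounded l : continuous f -> 0 < l -> exists k C, 0 <= C /\
  forall phi M, sbound k k phi M -> rnorm (rescaled l phi) <= C * M.
Proof.
move=> cf l0; have [k Hk] := continuous_bounded cf.
exists k, (`|rho l| * (k.+1%:R * ((1 + l^-1) ^+ k * (1 + l) ^+ k))); split.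
  by rewrite !mulr_ge0 ?exprn_ge0 ?addr_ge0 ?invr_ge0 ?(ltW l0).
move=> phi M b; rewrite /rescaled rnormZ -mulrA ler_wpM2l// -mulrA.
exact: Hk (sbound_dilate l0 b).
Qed.

(** The cut at [2 ^ j] telescopes into the cut at 1 and the blocks at [2 ^ i], [i < j]. Dilation
    turns [T_l] on a block into [T] at [2 ^ i * l], hence the condition that these points lie in
    [Lam]. *)
Lemma dyadic_sum (Lam : set R) k C q :
  (forall l, Lam l -> 0 < l) -> 0 <= C ->
  (forall l, Lam l -> forall phi M, supported 4 phi -> sbound k 0 phi M ->
     rnorm (rescaled l phi) <= C * M) ->
  (forall l, Lam l -> 0 <= rho l) ->
  (forall l, Lam l -> Lam (2 * l) -> rho l <= 2 ^+ q * rho (2 * l)) ->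
  exists B, 0 <= B /\ forall j l, (forall i, (i <= j)%N -> Lam (2 ^+ i * l)) ->
    forall phi M, sbound k (k + q.+1) phi M ->
    rnorm (rescaled l (cutS (2 ^+ j) phi)) <= B * M.
Proof.
move=> Lpos C0 equi rho0 dbl.
have [A1 A10 H1] := @cut_sbound R n k.
(* Doubling [rho] costs [2 ^+ (q * i)] on block [i]; one more power of decay leaves the summable
   factor [2 ^- i]. *)
have [A2 A20 H2] := @block_sbound R n k q.+1.
exists (C * A1 + 2 * (C * A2)); split.
  by rewrite addr_ge0 ?mulr_ge0.
move=> j l Ll phi M b; have M0 := sbound_ge0 b.
have l0 : 0 < l by have := Ll 0%N (leq0n j); rewrite expr0 mul1r; exact: Lpos.
have ln0 : l != 0 by rewrite gt_eqF.
have p2 i : 0 < 2 ^+ i :> R by rewrite exprn_gt0.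
have L0 : Lam l by have := Ll 0%N (leq0n j); rewrite expr0 mul1r.
have rho_le i : (i <= j)%N -> rho l <= 2 ^+ (q * i) * rho (2 ^+ i * l).
  elim: i => [_|i IH ij]; first by rewrite muln0 expr0 !mul1r.
  have := dbl _ (Ll _ (ltnW ij)); rewrite mulrA -exprS => /(_ (Ll _ ij)) h.
  apply: (le_trans (IH (ltnW ij))).
  by rewrite mulnS addnC exprD -mulrA ler_wpM2l ?exprn_ge0.
have step i : (i < j)%N ->
    rnorm (rescaled l (cutS (2 * 2 ^+ i) phi - cutS (2 ^+ i) phi)) <= C * A2 * M * 2 ^- i.
  move=> ij; rewrite -block_dilate//.
  apply: (le_trans (rescaled_dilate _ ln0 _ (b := 2 ^+ (q * i)) _ _)).
  - by rewrite gt_eqF.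
  - by rewrite rho0//= (mulrC l); exact: rho_le (ltnW ij).
  - by rewrite exprn_ge0.
  have bb := H2 (2 ^+ i) phi M _ b.
  have := equi _ (Ll _ (ltnW ij)) _ _ (block_supported phi (p2 i)) (bb _).
  rewrite exprn_ege1 ?ler1n// mulrC => /(_ isT) h.
  apply: (le_trans (ler_wpM2l _ h)); first by rewrite exprn_ge0.
  rewrite [leLHS](_ : _ = C * A2 * M * (2 ^+ (q * i) * (2 ^+ i) ^- q.+1)); last by ring.
  rewrite ler_wpM2l ?mulr_ge0// -exprM mulnS exprD invfM mulrCA (mulnC i).
  by rewrite divff ?mulr1// gt_eqF.
(* [2 - 2 * 2 ^- i] is the sum of [2 ^- t] over [t < i]. *)
suff H i : (i <= j)%N -> rnorm (rescaled l (cutS (2 ^+ i) phi)) <=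
    C * A1 * M + C * A2 * M * (2 - 2 * 2 ^- i).
  apply: (le_trans (H j (leqnn j))); rewrite [leRHS]mulrDl lerD2l.
  rewrite [leRHS](_ : _ = C * A2 * M * 2); last by ring.
  by rewrite ler_wpM2l ?mulr_ge0// gerBl mulr_ge0// invr_ge0 ltW.
elim: i => [|i IH] ij.
  rewrite expr0 invr1 mulr1 subrr mulr0 addr0 -mulrA.
  apply: equi => //.
    move=> x x4; rewrite [LHS](congr1 (@^~ x) (cutE phi ltr01)).
    by rewrite /= dilate_cutoffC0 ?mul0r//; lra.
  apply: H1; exact: sbound_le b.
have -> : cutS (2 ^+ i.+1) phi = cutS (2 ^+ i) phi +
    (cutS (2 * 2 ^+ i) phi - cutS (2 ^+ i) phi) by rewrite exprS addrC subrK.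
rewrite rescaledD//; apply: (le_trans (rnormD _ _)).
have e2 : 2 ^- i = 2 * 2 ^- i.+1 :> R by rewrite exprS invfM mulrA divff ?mul1r.
have := IH (ltnW ij); have := step i ij; rewrite e2.
move: (rnorm _) (rnorm _) => u v.
move: (C * A1 * M) (C * A2 * M) (2 ^- i.+1) => x y z; lra.
Qed.

End uniform_bound.

Section uniform_bound_on_schwartz.
Context {R : realType} {n : nat} {E : normedModType R[i]}.
Variables (f : {linear schwartz R n -> E}) (rho : R -> R).
Hypothesis f_cont : continuous f.
Implicit Types (phi psi : schwartz R n) (k m q p : nat) (M C l a : R).

Notation cutS a phi := (testfun_schwartz (cut a phi)).
Local Notation T := (rescaled f rho).

Variables (Lam : set R) (k : nat) (C : R) (q : nat).
Hypothesis Lam_pos : forall l, Lam l -> 0 < l.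
Hypothesis C_ge0 : 0 <= C.
Hypothesis equi : forall l, Lam l -> forall phi M, supported 4 phi ->
  sbound k 0 phi M -> rnorm (T l phi) <= C * M.
Hypothesis rho_ge0 : forall l, Lam l -> 0 <= rho l.
Hypothesis rho_doubling : forall l, Lam l -> Lam (2 * l) -> rho l <= 2 ^+ q * rho (2 * l).

Lemma rescaled_cut_split l a phi : l != 0 ->
  rnorm (T l phi) <= rnorm (T l (cutS a phi)) + rnorm (T l (phi - cutS a phi)).
Proof.
move=> l0; have := rnormD (T l (phi - cutS a phi)) (T l (cutS a phi)).
by rewrite -rescaledD// subrK addrC.
Qed.

Lemma exp2_small (K e : R) : 0 < e -> exists j : nat, K * 2 ^- j <= e.
Proof.
move=> e0; have c0 : 0 < e / (`|K| + 1) by rewrite divr_gt0// ltr_wpDl.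
have [j _ /(_ j (leqnn j))] := near_infty_natSinv_lt (PosNum c0).
rewrite /= => H; exists j; apply: (@le_trans _ _ ((`|K| + 1) * j.+1%:R^-1)).
  apply: (@le_trans _ _ ((`|K| + 1) * 2 ^- j)).
    by rewrite ler_wpM2r ?invr_ge0 ?exprn_ge0// (le_trans (ler_norm _))// lerDl.
  rewrite ler_wpM2l ?addr_ge0// lef_pV2 ?posrE ?exprn_gt0 ?ltr0n//.
  by rewrite -natrX ler_nat ltn_expl.
by rewrite mulrC -ler_pdivlMr ?ltr_wpDl// ltW.
Qed.

(** Here [j] is unrestricted. For fixed [l] the remainder beyond [2 ^ j] tends to 0 because the
    single [T_l] is bounded; its constants depend on [l] and [phi] but vanish in the limit. *)
Lemma uniform_bound_upward : (forall l, Lam l -> Lam (2 * l)) ->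
  exists k m B, forall l, Lam l -> forall phi M, sbound k m phi M ->
    rnorm (T l phi) <= B * M.
Proof.
move=> Lam2.
have [B [B0 HB]] := dyadic_sum Lam_pos C_ge0 equi rho_ge0 rho_doubling.
exists k, (k + q.+1)%N, B => l Ll phi M b.
have l0 := Lam_pos Ll.
have Lj i : Lam (2 ^+ i * l).
  by elim: i => [|i IH]; rewrite ?expr0 ?mul1r// exprS -mulrA; exact: Lam2.
have [k0 [C0 [C00 HC0]]] := rescaled_bounded rho f_cont l0.
have [M' b'] := schwartz_sbound k0 (k0 + 1) phi.
have [A A0 HA] := @cut_tail R n k0 k0 1.
apply/ler_addgt0Pr => e e0.
have [j Hj] := exp2_small (C0 * (A * M')) e0.
have ln0 : l != 0 by rewrite gt_eqF.
apply: (le_trans (rescaled_cut_split (2 ^+ j) phi ln0)); apply: lerD.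
  by apply: HB b => i _.
have a1 : 1 <= 2 ^+ j :> R by rewrite exprn_ege1// ler1n.
apply: le_trans (HC0 _ _ (HA _ _ _ a1 b')) _; apply: le_trans Hj.
by rewrite expr1 le_eqVlt; apply/orP; left; apply/eqP; ring.
Qed.

Lemma uniform_bound_origin (l1 c : R) p : 0 < l1 <= 1 -> 0 <= c ->
  (forall l, Lam l <-> 0 < l < l1) -> (forall l, Lam l -> rho l <= c * l ^- p) ->
  exists k m B, forall l, Lam l -> forall phi M, sbound k m phi M ->
    rnorm (T l phi) <= B * M.
Proof.
move=> /andP[l10 l11] c0 LamE rhoc.
have [B [B0 HB]] := dyadic_sum Lam_pos C_ge0 equi rho_ge0 rho_doubling.
have [k0 Hk0] := continuous_bounded f_cont.
(* The decay [p + k0] compensates [l ^- p] from [rho] and [l ^- k0] from the dilation. *)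
have [A A0 HA] := @cut_tail R n k0 k0 (p + k0).
pose D := c * (k0.+1%:R * (2 ^+ k0 * 2 ^+ k0 * (A * ((2 / l1) ^+ (p + k0))))).
have D0 : 0 <= D.
  by rewrite !mulr_ge0 ?exprn_ge0 ?mulr_ge0 ?invr_ge0 ?(ltW l10).
exists (maxn k k0), (maxn (k + q.+1) (k0 + (p + k0)))%N, (B + D) => l Ll phi M b.
have M0 := sbound_ge0 b.
have /andP[l0 ll1] := (LamE l).1 Ll.
have ln0 : l != 0 by rewrite gt_eqF.
have p2 i : 0 < 2 ^+ i :> R by rewrite exprn_gt0.
(* The last scale inside the admissible interval; there [2 ^- j <= (2 / l1) * l], so decay in
   [2 ^ j] becomes powers of [l]. *)
have [j Lj lj] : exists2 j, 2 ^+ j * l < l1 & l1 <= 2 ^+ j.+1 * l.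
  have [i Hi] : exists i, l1 <= 2 ^+ i * l.
    have [i Hi] := exp2_small 1 (divr_gt0 l0 l10); exists i.
    by move: Hi; rewrite mul1r ler_pdivlMr// ler_pdivrMl.
  elim: i Hi => [|i IH] Hi; first by move: Hi; rewrite expr0 mul1r leNgt ll1.
  by have [/IH//|Hi'] := leP l1 (2 ^+ i * l); exists i.
rewrite mulrDl; apply: (le_trans (rescaled_cut_split (2 ^+ j) phi ln0)).
apply: lerD.
  apply: HB; last by apply: sbound_le b; rewrite // ?leq_maxl.
  move=> i ij; apply/LamE; rewrite mulr_gt0//= (le_lt_trans _ Lj)//.
  by rewrite ler_wpM2r ?(ltW l0)// ler_weXn2l// ler1n.
have a1 : 1 <= 2 ^+ j :> R by rewrite exprn_ege1// ler1n.
have bb := HA _ phi M a1 (sbound_le (leq_maxr _ _) (leq_maxr _ _) (lexx _) b).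
have := Hk0 _ _ (sbound_dilate l0 bb).
rewrite /T /rescaled rnormZ (ger0_norm (rho_ge0 Ll)) => H.
have r0 := rho_ge0 Ll.
apply: (le_trans (ler_wpM2l r0 H)).
have K0 : 0 <= (1 + l^-1) ^+ k0 * (1 + l) ^+ k0 * (A * 2 ^+ j ^- (p + k0) * M).
  by rewrite !mulr_ge0 ?exprn_ge0 ?addr_ge0 ?invr_ge0 ?exprn_ge0 ?(ltW l0) ?(ltW (p2 _)).
apply: (le_trans (ler_wpM2r (mulr_ge0 (ler0n _ _) K0) (rhoc _ Ll))).
have li1 : 1 <= l^-1 by rewrite invf_ge1// (le_trans (ltW ll1)).
have e1 : (1 + l^-1) ^+ k0 <= 2 ^+ k0 * l ^- k0.
  rewrite -exprVn -exprMn lerXn2r ?nnegrE ?addr_ge0 ?mulr_ge0 ?invr_ge0 ?(ltW l0)//.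
  by move: li1; lra.
have e2 : (1 + l) ^+ k0 <= 2 ^+ k0.
  rewrite lerXn2r ?nnegrE ?addr_ge0 ?(ltW l0)//.
  by move: ll1 l11; lra.
have e3 : 2 ^+ j ^- (p + k0) <= (2 / l1) ^+ (p + k0) * l ^+ (p + k0).
  rewrite -exprVn -exprMn lerXn2r ?nnegrE ?mulr_ge0 ?invr_ge0 ?(ltW l0) ?(ltW l10) ?(ltW (p2 _))//.
  rewrite -ler_pdivrMr// -invfM.
  rewrite -[2 / l1]invrK lef_pV2 ?posrE ?invr_gt0 ?divr_gt0 ?mulr_gt0// invf_div.
  by rewrite ler_pdivrMr// mulrC mulrA -exprS.
set e := _ ^- (p + k0) in e3 *.
have e0 : 0 <= e by rewrite invr_ge0 exprn_ge0// ltW.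
apply: (@le_trans _ _ (c * l ^- p * (k0.+1%:R * (2 ^+ k0 * l ^- k0 * 2 ^+ k0 *
    (A * ((2 / l1) ^+ (p + k0) * l ^+ (p + k0)) * M))))).
  rewrite ler_wpM2l ?mulr_ge0 ?invr_ge0 ?exprn_ge0 ?(ltW l0)// ler_wpM2l//.
  apply: ler_pM => //.
  - by rewrite mulr_ge0 ?exprn_ge0 ?addr_ge0 ?invr_ge0 ?(ltW l0).
  - by rewrite !mulr_ge0.
  - by apply: ler_pM; rewrite // exprn_ge0 ?addr_ge0 ?invr_ge0 ?(ltW l0).
  - by rewrite ler_wpM2r// ler_wpM2l.
rewrite le_eqVlt; apply/orP; left; apply/eqP.
rewrite /D exprD [l ^+ (p + k0)]exprD; field.
by rewrite !expf_neq0 ?ln0 ?gt_eqF.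
Qed.

End uniform_bound_on_schwartz.

(** * Extension of the limit *)

Section extension.
Context {R : realType} {n : nat} {E : completeNormedModType R[i]}.
Variables (f : {linear schwartz R n -> E}) (g : {linear testfun R n -> E}) (rho : R -> R).
Implicit Types (phi psi : schwartz R n) (k m : nat) (M l a : R).

Notation cutS a phi := (testfun_schwartz (cut a phi)).
Local Notation T := (rescaled f rho).

Variables (F : set_system R) (FF : ProperFilter F) (U : set R).
Hypothesis FU : F U.
Hypothesis U_neq0 : forall l, U l -> l != 0.
Hypothesis T_cvg : forall chi : testfun R n, T ^~ (testfun_schwartz chi) @ F --> g chi.
Variables (k m : nat) (B : R).
Hypothesis T_bound : forall l, U l -> forall phi M, sbound k m phi M ->
  rnorm (T l phi) <= B * M.

Let FF' : Filter F := @filter_filter R F FF.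

(** By equicontinuity [T_l] is uniformly small on the remainder of a far cut, so [T_l phi]
    eventually stays near the value of [g] on the cut. Completeness of [E] concludes. *)
Lemma rescaled_is_cvg phi : cvg (T ^~ phi @ F).
Proof.
apply/cauchy_cvgP; apply: cauchy_exP => e e0.
have Ee : e = (complex.Re e)%:C.
  by move: e0; case: (e) => a b; rewrite ltcE/= => /andP[/eqP -> _].
have e0' : 0 < complex.Re e / 2 by rewrite divr_gt0// -ltcR -Ee.
have [M b] := schwartz_sbound k (m + 1) phi.
have [A A0 HA] := @cut_tail R n k m 1.
have [j Hj] := exp2_small (`|B| * (A * M)) e0'.
have a1 : 1 <= 2 ^+ j :> R by rewrite exprn_ege1// ler1n.
exists (g (cut (2 ^+ j) phi)).
have := iffLR (@cvg_rnorm _ E _ F FF' _ _) (@T_cvg (cut (2 ^+ j) phi)) _ e0'.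
move=> /(filterI FU); apply: (@filterS _ F) => l [Ul H].
rewrite -ball_normE/= rnormE [ltRHS]Ee ltcR.
rewrite -(subrK (T l (cutS (2 ^+ j) phi)) (g _)) -addrA (le_lt_trans (rnormD _ _))//.
rewrite [ltRHS]splitr ltr_leD//.
rewrite -rnormN opprB -rescaledB ?U_neq0//.
apply: (le_trans (T_bound Ul (HA _ _ _ a1 b))); apply: le_trans Hj.
rewrite expr1 [A * _ * M]mulrAC -mulrA !mulrA ler_wpM2r ?invr_ge0 ?exprn_ge0//.
have M0 := sbound_ge0 b.
by rewrite ler_wpM2r// ler_wpM2r// ler_norm.
Qed.

Let G phi : E := lim (T ^~ phi @ F).

Let G_cvg phi : T ^~ phi @ F --> G phi.
Proof. exact: rescaled_is_cvg. Qed.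

Let G_linear : linear G.
Proof.
move=> a phi psi; apply: (@cvg_lim E) => //.
have : (fun l => a *: T l phi + T l psi) @ F --> a *: G phi + G psi.
  by apply: cvgD; [apply: cvgZr|]; exact: G_cvg.
apply: cvg_trans; apply: near_eq_cvg; apply: filterS FU => l Ul.
by rewrite rescaledD ?rescaledZ// U_neq0.
Qed.

Lemma extension_exists : exists G : {linear schwartz R n -> E},
  [/\ continuous G, (forall chi, G (testfun_schwartz chi) = g chi)
    & forall phi, T ^~ phi @ F --> G phi].
Proof.
pose G' : {linear schwartz R n -> E} :=
  HB.pack G (GRing.isLinear.Build R[i] (schwartz R n) E _ G G_linear).
exists G'; split; last exact: G_cvg.
  apply: (@bounded_continuous _ _ E G' k m B) => phi M b.
  apply/ler_addgt0Pr => e e0.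
  have := iffLR (@cvg_rnorm _ E _ F FF' _ _) (@G_cvg phi) _ e0.
  move=> /(filterI FU)/filter_ex[l [Ul H]].
  rewrite -[G' phi](subrK (T l phi)) addrC (le_trans (rnormD _ _))//.
  by rewrite lerD ?T_bound// ltW.
by move=> chi; apply: (@cvg_lim E) => //; exact: T_cvg.
Qed.

End extension.

(** * Lower bound for slowly varying functions *)

Section slow_variation.
Context {R : realType}.
Implicit Types (L : R -> R).

Local Notation mu := (@lebesgue_measure R).

Lemma near_right0 (P : R -> Prop) : (\forall l \near 0^'+, P l) ->
  exists2 d : R, 0 < d & forall l, 0 < l < d -> P l.
Proof.
move=> [d /= d0 dP]; exists d => // l /andP[l0 ld]; apply: dP => //=.
by rewrite sub0r normrN gtr0_norm.
Qed.

Definition mul_by (l : R) (u : measurableTypeR R) : measurableTypeR R := l * u.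

Lemma measurable_mul_by l : measurable_fun [set: measurableTypeR R] (mul_by l).
Proof. exact: mulrl_measurable. Qed.

(** Both sides are measures in [A] with the same values on half-open intervals, which determine
    Lebesgue measure. *)
Lemma lebesgue_measure_scale (l : R) (A : set (measurableTypeR R)) :
  0 < l -> measurable A ->
  (l%:E * mu (mul_by l @^-1` A) = mu A)%E.
Proof.
move=> l0 mA.
have ml := measurable_mul_by l.
pose m : {measure set (measurableTypeR R) -> \bar R} :=
  mscale (NngNum (ltW l0)) (pushforward mu (mul_by l)).
suff : mu A = m ml A by move=> ->.
apply: (@lebesgue_measure_unique R (m ml)) => //= _ [[a b]] _ <-.
have E : mul_by l @^-1` `]a, b] = `]l^-1 * a, l^-1 * b]%classic.
  apply/seteqP; split=> u; rewrite /mul_by /= !in_itv/=;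
    by rewrite ltr_pdivrMl// ler_pdivlMl.
rewrite /m /mscale /= /pushforward E.
rewrite !lebesgue_measure_itv/= !lte_fin ltr_pM2l ?invr_gt0//.
case: ifPn => _; last by rewrite mule0.
by rewrite -!EFinD -EFinM -mulrBr mulrA divff ?gt_eqF// mul1r.
Qed.

(** Since [L > 0], the sets where [L >= 1 / (i + 1)] exhaust the interval, and continuity of the
    measure makes the rest small. These sets are only Lebesgue measurable, so each is replaced by a
    Borel subset with negligible difference. *)
Lemma superlevel_subset L (A x y e : R) :
  measurable_fun (`]0, A[ : set (lebesgue_type R)) L ->
  (forall z, 0 < z < A -> 0 < L z) -> 0 < x -> y < A -> 0 < e ->
  exists d (B : set (measurableTypeR R)), [/\ 0 < d, measurable B,
    forall z, B z -> d <= L z & (mu (`[x, y]%classic `\` B) <= e%:E)%E].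
Proof.
move=> mL Lpos x0 yA e0.
have borel (X : set (measurableTypeR R)) : measurable X ->
    measurable (X : set (lebesgue_type R)).
  move=> mX; apply: sub_sigma_algebra; exists X => //; exists set0; last by rewrite setU0.
  exact: negligible_set0.
have /choice[X HX] (i : nat) : exists X : set (measurableTypeR R),
    [/\ measurable X, X `<=` [set z | i.+1%:R^-1 <= L z] &
      mu.-negligible ([set z | 0 < z < A /\ i.+1%:R^-1 <= L z] `\` X)].
  have := mL (borel _ (measurable_itv _)) _ (measurable_itv `[(i.+1%:R : R)^-1, +oo[).
  have := @g_sigma_completed_algebra_genE R => GE.
  move=> mS.
  have [X mX [N negN XN]] : completed_algebra_gen mu
      (`]0, A[ `&` L @^-1` `[(i.+1%:R : R)^-1, +oo[) by rewrite -GE; exact: mS.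
  exists X; split=> //.
    move=> z Xz; have : (X `|` N) z by left.
    by rewrite XN => -[_] /=; rewrite in_itv/= andbT.
  apply: negligibleS negN => z [[zA Lz] nXz].
  suff : (X `|` N) z by case.
  by rewrite XN; split; rewrite /= in_itv/= ?zA ?Lz.
pose F m : set (measurableTypeR R) := `[x, y]%classic `\` \bigcup_(i in `I_m) X i.
have mF m : measurable (F m).
  apply: measurableD; first exact: measurable_itv.
  by apply: bigcup_measurable => i _; have [] := HX i.
have cF : mu (\bigcap_m F m) = 0%E.
  apply: measure_negligible; first exact: bigcapT_measurable.
  have negl (i : nat) : mu.-negligible
      ([set z | 0 < z < A /\ i.+1%:R^-1 <= L z] `\` X i) by have [] := HX i.
  apply: negligibleS (negligible_bigcup negl).
  move=> z Fz; have [zxy _] := Fz 0%N I.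
  move: zxy; rewrite /= in_itv/= => /andP[xz zy].
  have zA : 0 < z < A by rewrite (lt_le_trans x0 xz) (le_lt_trans zy yA).
  have [i _ /(_ i (leqnn i)) Hi] := near_infty_natSinv_lt (PosNum (Lpos z zA)).
  have [_ nXz] := Fz i.+1 I; exists i => //.
  split; [by split; [|exact: ltW]|by move=> Xz; apply: nXz; exists i => /=].
have cv : mu \o F @ \oo --> mu (\bigcap_m F m).
  apply: nonincreasing_cvg_mu => //.
  - apply: (@le_lt_trans _ _ (mu `[x, y]%classic)).
      by apply: le_measure; rewrite ?inE//; exact: subDsetl.
    by rewrite lebesgue_measure_itv/=; case: ifP => _; rewrite ?ltry// -EFinD ltry.
  - exact: bigcapT_measurable.
  move=> i j ij; apply/subsetPset; apply: setDS => z [k /= ki Xz].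
  by exists k => //=; exact: leq_trans ki ij.
have [m Fm] : exists m, (mu (F m) <= e%:E)%E.
  apply: contrapT => /forallNP H.
  suff : (e%:E <= mu (\bigcap_m F m))%E by rewrite cF lee_fin leNgt e0.
  rewrite -(cvg_lim _ cv)//; apply: lime_ge; first by apply/cvg_ex; eexists; exact: cv.
  by apply: nearW => m; have /negP := H m; rewrite -ltNge => /ltW.
exists m.+1%:R^-1, (\bigcup_(i in `I_m) X i); split=> //.
  by apply: bigcup_measurable => i _; have [] := HX i.
move=> z [i /= im Xz]; have [_ /(_ z Xz) /= h _] := HX i.
by apply: le_trans h; rewrite lef_pV2 ?posrE ?ltr0n// ler_nat ltnW// ltnS ltnW.
Qed.

(* The only use of the measurability of [L]. Otherwise there are points [l_N]
   near [w_N = c 2^-N] where [L] is far below a level [d_N] that it exceeds on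
   nearly all of [w_N / 2, 2 w_N]. By slow variation every [u] in [1, 2]
   eventually satisfies [L(u l_N) < d_N], so the measure of [1, 2] is at most
   the lower limit of small numbers. *)
Lemma slowly_varying0_window L : slowly_varying0 L ->
  forall c, 0 < c -> exists w d, [/\ 0 < w, w < c, 0 < d & forall l, w / 2 <= l <= w -> d <= L l].
Proof.
move=> [A [A0 mL Lpos Lsv]] c c0.
pose b := Num.min A c.
have b0 : 0 < b by rewrite lt_min A0.
(* The factor 1/4 keeps [[w N / 2, 2 * w N]] below [A] and [w N] below [c]. *)
pose w N := b / 4 * 2 ^- N.
have p0 N : 0 < 2 ^- N :> R by rewrite invr_gt0 exprn_gt0.
have w0 N : 0 < w N by rewrite mulr_gt0 ?divr_gt0.
have wb N : w N <= b / 4.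
  by rewrite ler_piMr ?divr_ge0 ?(ltW b0)// invf_le1 ?exprn_gt0// exprn_ege1// ler1n.
have bA : b <= A by rewrite ge_min lexx.
have bc : b <= c by rewrite ge_min lexx orbT.
apply: contrapT => H.
have bad N d : 0 < d -> exists l, w N / 2 <= l <= w N /\ L l < d.
  move=> d0; apply: contrapT => /forallNP Hl; apply: H; exists (w N), d; split=> //.
    by have := wb N; lra.
  by move=> l lw; rewrite leNgt; apply/negP => Ld; apply: (Hl l).
have win N : exists d (B : set (measurableTypeR R)), [/\ 0 < d, measurable B,
    forall z, B z -> d <= L z &
    (mu (`[(w N / 2)%R, (2 * w N)%R]%classic `\` B) <= (w N / 8)%:E)%E].
  apply: superlevel_subset mL Lpos _ _ _; rewrite ?divr_gt0//.
  by have := wb N; lra.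
have /choice[d /choice[B HB]] := win.
(* Half the level, since the ratio [L (u * l) / L l] is only known to be below 2. *)
have /choice[l Hl] N : exists l, w N / 2 <= l <= w N /\ L l < d N / 2.
  by apply: bad; rewrite divr_gt0//; have [] := HB N.
have l0 N : 0 < l N by have [/andP[h _] _] := Hl N; have := w0 N; lra.
pose C N : set (measurableTypeR R) :=
  mul_by (l N) @^-1`
    (`[(w N / 2)%R, (2 * w N)%R]%classic `\` B N).
have mC0 N : measurable (`[(w N / 2)%R, (2 * w N)%R]%classic `\` B N : set (measurableTypeR R)).
  by apply: measurableD; [exact: measurable_itv|have [] := HB N].
have mC N : measurable (C N).
  by rewrite -[C N]setTI; exact: measurable_mul_by.
(* Scaling divides a measure of at most [w N / 8] by [l N >= w N / 2]. *)
have muC N : (mu (C N) <= (1 / 4)%:E)%E.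
  have [_ _ _] := HB N; rewrite -(lebesgue_measure_scale (l0 N) (mC0 N)) -/(C N).
  rewrite -lee_pdivlMl//; move=> h; apply: (le_trans h); rewrite -EFinM lee_fin.
  have [/andP[h1 _] _] := Hl N; rewrite ler_pdivrMl//.
  by have := w0 N; lra.
pose D M := \bigcap_(N in [set N | (M <= N)%N]) C N.
have mD M : measurable (D M) by apply: bigcap_measurable => //; exists M => /=.
have cover : `[1, 2]%classic `<=` \bigcup_M D M.
  move=> u /=; rewrite in_itv/= => /andP[u1 u2].
  have u0 : 0 < u by rewrite (lt_le_trans ltr01).
  have /cvgrPdist_lt/(_ _ (ltr01 : 0 < 1 :> R))/near_right0[eta eta0 Heta] := Lsv u u0.
  have [M HM] := exp2_small (b / 4) (divr_gt0 eta0 (ltr0n _ 2)).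
  exists M => // N /= MN.
  have wN : w N <= eta / 2.
    apply: le_trans HM; rewrite ler_wpM2l ?divr_ge0 ?(ltW b0)//.
    by rewrite lef_pV2 ?posrE ?exprn_gt0// ler_weXn2l// ler1n.
  have [/andP[h1 h2] h3] := Hl N.
  split=> /=.
    rewrite /mul_by in_itv/=; apply/andP; split.
      by rewrite (le_trans h1)// ler_peMr// ltW.
    by rewrite mulrC ler_pM ?(ltW u0) ?(ltW (l0 N)).
  rewrite /mul_by => BN; have [_ _ /(_ _ BN) h4 _] := HB N.
  have lA : 0 < l N < A by rewrite l0 /=; have := wb N; lra.
  have L0 := Lpos _ lA.
  have leta : 0 < l N < eta by rewrite l0 /=; lra.
  have := Heta _ leta; rewrite ltr_norml => /andP[+ _].
  rewrite ltrBrDr -ltrBrDl opprK => h5.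
  have : L (u * l N) < 2 * L (l N) by rewrite -ltr_pdivrMr//; move: h5; lra.
  by rewrite mulrC; lra.
have ndD : nondecreasing_seq D.
  move=> i j ij; apply/subsetPset => u Du N /= jN; apply: Du => /=.
  exact: leq_trans ij jN.
have mUD : measurable (\bigcup_M D M) by exact: bigcupT_measurable.
have cvD := nondecreasing_cvg_mu (mu := mu) mD mUD ndD.
have h1 : (mu (\bigcup_M D M) <= (1 / 4)%:E)%E.
  rewrite -(cvg_lim _ cvD)//; apply: lime_le; first by apply/cvg_ex; eexists; exact: cvD.
  apply: nearW => M /=; apply: le_trans (muC M); apply: le_measure; rewrite ?inE//.
  by move=> u; apply => /=.
have : (mu `[1%R, 2%R]%classic <= (1 / 4)%:E)%E.
  by apply: le_trans h1; apply: le_measure; rewrite ?inE//; exact: measurable_itv.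
rewrite lebesgue_measure_itv/= lte_fin ltrDl ltr01 -EFinD lee_fin.
lra.
Qed.

(** Doubling gives [L l / l >= L (2 * l) / (2 * l)]. Repeated doubling brings [l] into the window,
    where the quotient is at least [d / w]. *)
Lemma slowly_varying0_lower_bound L : slowly_varying0 L ->
  exists l1 c, [/\ 0 < l1, 0 < c & forall l, 0 < l < l1 ->
    c * l <= L l /\ L (2 * l) <= 2 * L l].
Proof.
move=> sL; have [A [A0 mL Lpos Lsv]] := sL.
have /cvgrPdist_lt/(_ _ (ltr01 : 0 < 1 :> R))/near_right0[eta eta0 Heta] := Lsv 2 (ltr0n _ 2).
pose b := Num.min A eta.
have b0 : 0 < b by rewrite lt_min A0.
have dbl l : 0 < l < b -> L (2 * l) <= 2 * L l.
  rewrite lt_min => /and3P[l0 lA le].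
  have L0 : 0 < L l by rewrite Lpos// l0.
  have := Heta l; rewrite l0 le => /(_ isT); rewrite ltr_norml => /andP[h _].
  by rewrite -ler_pdivrMr//; lra.
have [w [d [w0 wb d0 Hw]]] := slowly_varying0_window sL b0.
exists w, (d / w); split=> //; first by rewrite divr_gt0.
move=> l /andP[l0 lw]; split; last by apply: dbl; rewrite l0 (lt_trans lw).
have [i Hi] : exists i, w / 2 <= 2 ^+ i * l.
  have [i Hi] := exp2_small (w / 2) l0; exists i.
  by move: Hi; rewrite ler_pdivrMr ?exprn_gt0// [leRHS]mulrC.
elim: i l l0 lw Hi => [|i IH] l l0 lw Hi.
  rewrite expr0 mul1r in Hi.
  apply: (@le_trans _ _ d); last by apply: Hw; rewrite Hi (ltW lw).
  by rewrite mulrAC ler_pdivrMr// ler_wpM2l ?(ltW d0) ?(ltW lw).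
have [lw2|lw2] := leP w (2 * l).
  apply: (@le_trans _ _ d); first by rewrite mulrAC ler_pdivrMr// ler_wpM2l ?(ltW d0) ?(ltW lw).
  by apply: Hw; rewrite (ltW lw) andbT; lra.
have l20 : 0 < 2 * l by rewrite mulr_gt0.
have := IH (2 * l) l20 lw2; rewrite mulrA -exprSr => /(_ Hi) h.
have := dbl l; rewrite l0 (lt_trans lw wb) => /(_ isT) h2.
have : d / w * (2 * l) = 2 * (d / w * l) by ring.
by move: h h2; lra.
Qed.

End slow_variation.

(** * Proof of the theorem *)

Section assembly.
Context {R : realType} {n : nat} {E : completeNormedModType R[i]}.
Variables (f : {linear schwartz R n -> E}) (g : {linear testfun R n -> E}).
Variables (alpha : R) (L : R -> R).
Hypothesis f_cont : continuous f.

Definition gauge l : R := (l `^ alpha * L l)^-1 * l ^- n.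

Lemma rescaledE l phi : rescaled f gauge l phi =
  ((l `^ alpha * L l)^-1)%:C *: pairing_dilate n (@schwartz_dilate R n) f l phi.
Proof. by rewrite /rescaled /gauge rmorphM -scalerA. Qed.

Lemma exponent_bound : exists p : nat, alpha <= p%:R.
Proof.
exists (Num.truncn `|alpha|).+1; apply: ltW.
by rewrite (le_lt_trans (ler_norm _))// truncnS_gt.
Qed.

Lemma gauge_gt0 l : 0 < l -> 0 < L l -> 0 < gauge l.
Proof.
by move=> l0 Ll; rewrite mulr_gt0 ?invr_gt0 ?mulr_gt0 ?powR_gt0 ?exprn_gt0.
Qed.

(** In the exponent, [p] comes from [l ^ alpha], [n] from the Jacobian and 1 from the ratio of the
    values of [L]. *)
Lemma gauge_doubling p l : alpha <= p%:R -> 0 < l -> 0 < L (2 * l) ->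
  L (2 * l) <= 2 * L l -> gauge l <= 2 ^+ (p + n).+1 * gauge (2 * l).
Proof.
move=> ap l0 L2 L2l; have L0 : 0 < L l by lra.
have a2 : (2 : R) `^ alpha <= 2 ^+ p.
  by rewrite -powR_mulrn// ler_powR// ler1n.
have pw : 0 < l `^ alpha by rewrite powR_gt0.
have pw2 : 0 < (2 : R) `^ alpha by rewrite powR_gt0.
rewrite /gauge powRM ?(ltW l0)// exprMn.
set x := l `^ alpha in pw *; set y := 2 `^ alpha in a2 pw2 *.
rewrite [leRHS](_ : _ = (2 ^+ p / y) * (2 * L l / L (2 * l)) * ((x * L l)^-1 * l ^- n)).
  rewrite ler_peMl ?mulr_ge0 ?invr_ge0 ?mulr_ge0 ?exprn_ge0 ?(ltW pw) ?(ltW L0) ?(ltW l0)//.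
  by rewrite mulr_ege1// ler_pdivlMr// mul1r.
rewrite exprS exprD; field.
by rewrite !gt_eqF ?exprn_gt0.
Qed.

(** For [l <= 1], [alpha <= p] gives [l ^ p <= l ^ alpha]; the extra power comes from the linear
    lower bound of [L]. *)
Lemma gauge_le p c l : alpha <= p%:R -> 0 < c -> 0 < l <= 1 -> c * l <= L l ->
  gauge l <= c^-1 * l ^- (p + 1 + n).
Proof.
move=> ap c0 /andP[l0 l1] cL.
have L0 : 0 < L l by rewrite (lt_le_trans _ cL)// mulr_gt0.
have pw : l ^+ p <= l `^ alpha.
  rewrite -powR_mulrn ?(ltW l0)// /powR gt_eqF// ler_expR.
  by rewrite ler_wnM2r// ln_le0.
have -> : c^-1 * l ^- (p + 1 + n) = (l ^+ p * (c * l))^-1 * l ^- n.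
  by rewrite !exprD expr1 !invfM; ring.
rewrite /gauge ler_wpM2r ?invr_ge0 ?exprn_ge0 ?(ltW l0)//.
rewrite lef_pV2 ?posrE ?mulr_gt0 ?exprn_gt0 ?powR_gt0//; apply: ler_pM => //.
  by rewrite exprn_ge0// ltW.
by rewrite mulr_ge0// ltW.
Qed.

Variables (F : set_system R) (FF : ProperFilter F) (Lam : nat -> set R).
Hypothesis Lam_decr : forall N N', (N <= N')%N -> Lam N' `<=` Lam N.
Hypothesis F_Lam : forall N, F (Lam N).
Hypothesis F_basis : forall U, F U -> exists N, Lam N `<=` U.
Hypothesis Lam_pos : forall l, Lam 0%N l -> 0 < l.
Hypothesis f_qa : quasiasymptotic n (@testfun_dilate R n) F alpha L
  (f \o @testfun_schwartz R n) g.

Lemma rescaled_testfun_cvg chi :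
  rescaled f gauge ^~ (testfun_schwartz chi) @ F --> g chi.
Proof.
apply: (cvg_trans _ (@f_qa chi)); apply: near_eq_cvg.
apply: filterS (F_Lam 0) => l /Lam_pos l0; rewrite rescaledE /pairing_dilate /=.
congr (_ *: (_ *: f _)); apply/val_inj/funext => x.
have ln0 : l != 0 by rewrite gt_eqF.
by rewrite [LHS](testfun_dilateE chi x ln0) [RHS](schwartz_dilateE _ x ln0).
Qed.

(** The radius 4 is that of the dyadic blocks. Convergence to [g chi] gives the pointwise bound
    [rnorm (g chi) + 1] on some [Lam N]. *)
Lemma rescaled_equicontinuous : exists k C, 0 <= C /\ forall l, Lam k l ->
  forall (phi : schwartz R n) M, supported 4 phi -> sbound k 0 phi M ->
  rnorm (rescaled f gauge l phi) <= C * M.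
Proof.
apply: (@banach_steinhaus R n E R (rescaled f gauge) Lam 4) => //.
- by move=> l /Lam_pos l0; apply: rescaledD; rewrite gt_eqF.
- by move=> l c phi /Lam_pos l0; apply: rescaledZ; rewrite gt_eqF.
- move=> l /Lam_pos l0; have [k [C [_ H]]] := rescaled_bounded gauge f_cont l0.
  by exists k, C.
move=> phi sphi.
have tphi : (phi : 'rV[R]_n -> R[i]) \in testfun_pred.
  by apply/asboolP; split; [exact: schwartz_smooth|exact: compact_supp sphi].
pose chi := Testfun tphi; have E1 : testfun_schwartz chi = phi by exact/val_inj.
have FF' : Filter F := @filter_filter R F FF.
have := iffLR (@cvg_rnorm _ E _ F FF' _ _) (@rescaled_testfun_cvg chi) _ ltr01.
move=> /F_basis[N HN]; exists N, (rnorm (g chi) + 1) => l /HN /=; rewrite E1 => H.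
have := rnormB (g chi) (g chi - rescaled f gauge l phi).
by rewrite opprB addrC subrK; move: H; lra.
Qed.

Lemma quasiasymptotic_extension k0 : (exists k m B, forall l, Lam k0 l ->
    forall (phi : schwartz R n) M, sbound k m phi M -> rnorm (rescaled f gauge l phi) <= B * M) ->
  exists G : {linear schwartz R n -> E},
    [/\ continuous G, (forall phi, G (testfun_schwartz phi) = g phi)
      & quasiasymptotic n (@schwartz_dilate R n) F alpha L f G].
Proof.
move=> [k [m [B H]]].
have U0 l : Lam k0 l -> l != 0.
  by move=> /(Lam_decr (leq0n _))/Lam_pos l0; rewrite gt_eqF.
have [G [cG eG GT]] := extension_exists FF (F_Lam k0) U0 rescaled_testfun_cvg H.
exists G; split=> // phi; apply: (cvg_trans _ (@GT phi)); apply: near_eq_cvg.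
by apply: filterS (F_Lam 0) => l _; rewrite rescaledE.
Qed.

End assembly.

Theorem corollary7p3 (R : realType) (n : nat) (E : completeNormedModType R[i])
    (alpha : R) (L : R -> R) (f : {linear schwartz R n -> E})
    (g : {linear testfun R n -> E}) (f_cont : continuous f)
    (g_cont : continuous g) :
  (slowly_varying0 L ->
   quasiasymptotic n (@testfun_dilate R n) 0^'+ alpha L
     (f \o @testfun_schwartz R n) g ->
   exists G : {linear schwartz R n -> E},
     [/\ continuous G, (forall phi, G (testfun_schwartz phi) = g phi)
       & quasiasymptotic n (@schwartz_dilate R n) 0^'+ alpha L f G]) /\
  (slowly_varyingy L ->
   quasiasymptotic n (@testfun_dilate R n) +oo alpha L
     (f \o @testfun_schwartz R n) g ->
   exists G : {linear schwartz R n -> E},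
     [/\ continuous G, (forall phi, G (testfun_schwartz phi) = g phi)
       & quasiasymptotic n (@schwartz_dilate R n) +oo alpha L f G]).
Proof.
have [p ap] := @exponent_bound R alpha.
split=> sv qa.
  have [l1 [c [l10 c0 Hl1]]] := slowly_varying0_lower_bound sv.
  (* The bound 1 serves the comparison of [l ^ alpha] with [l ^ p]. *)
  pose l2 := Num.min l1 1.
  have l20 : 0 < l2 by rewrite lt_min l10 ltr01.
  have l2l1 : l2 <= l1 by rewrite ge_min lexx.
  have l21 : l2 <= 1 by rewrite ge_min lexx orbT.
  pose Lam N := [set l : R | 0 < l < l2 / N.+1%:R].
  have lN0 N : 0 < l2 / N.+1%:R by rewrite divr_gt0// ltr0n.
  have lN N : l2 / N.+1%:R <= l2.
    by rewrite ler_pdivrMr ?ltr0n// ler_peMr ?(ltW l20)// ler1n.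
  have Lam_decr N N' : (N <= N')%N -> Lam N' `<=` Lam N.
    move=> NN l /= /andP[l0 h]; rewrite /Lam /= l0 /=; apply: (lt_le_trans h).
    by rewrite ler_wpM2l ?(ltW l20)// lef_pV2 ?posrE ?ltr0n// ler_nat.
  have F_Lam N : 0^'+ (Lam N).
    by near=> l => /=; apply/andP; split; near: l;
      [exact: nbhs_right_gt|exact: nbhs_right_lt].
  have F_basis U : 0^'+ U -> exists N, Lam N `<=` U.
    move=> /near_right0[d d0 dU].
    have [N _ /(_ N (leqnn N)) HN] := near_infty_natSinv_lt (PosNum (divr_gt0 d0 l20)).
    exists N => l /= /andP[l0 h]; apply: dU; rewrite l0 (lt_trans h)//.
    by rewrite mulrC -ltr_pdivlMr.
  have Lam_pos l : Lam 0%N l -> 0 < l by move=> /andP[].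
  have [k [C [C0 equi]]] := rescaled_equicontinuous f_cont _ Lam_decr F_Lam F_basis Lam_pos qa.
  apply: (quasiasymptotic_extension _ Lam_decr F_Lam Lam_pos qa (k0 := k)).
  have Lk l : Lam k l -> [/\ 0 < l, l <= 1, 0 < L l & c * l <= L l /\ L (2 * l) <= 2 * L l].
    move=> /= /andP[l0 h]; have h' := lt_le_trans h (lN k).
    have [|h1 h2] := Hl1 l; first by rewrite l0 (lt_le_trans h').
    split=> //; first by rewrite (le_trans (ltW h')).
    by rewrite (lt_le_trans _ h1)// mulr_gt0.
  have Lam_gt0 l : Lam k l -> 0 < l by move=> /Lk[].
  have gauge_ge0 l : Lam k l -> 0 <= @gauge R n alpha L l.
    by move=> /Lk[l0 _ Ll _]; apply/ltW/gauge_gt0.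
  have dbl l : Lam k l -> Lam k (2 * l) ->
      @gauge R n alpha L l <= 2 ^+ (p + n).+1 * @gauge R n alpha L (2 * l).
    by move=> /Lk[l0 _ Ll [_ h]] /Lk[_ _ L2 _]; exact: gauge_doubling.
  apply: (@uniform_bound_origin _ _ _ _ _ f_cont (Lam k) k C _ Lam_gt0 C0 equi
    gauge_ge0 dbl (l2 / k.+1%:R) c^-1 (p + 1 + n)) => //.
  - by rewrite lN0 (le_trans (lN k)).
  - by rewrite invr_ge0 ltW.
  - by move=> l /Lk[l0 l1' Ll [h _]]; apply: gauge_le => //; rewrite l0.
have [A [mL Lpos Lsv]] := sv.
have /cvgrPdist_lt/(_ _ (ltr01 : 0 < 1 :> R))[M [_ HM]] := Lsv 2 (ltr0n _ 2).
(* Beyond [a], [l] and [L l] are positive and [L (2 * l) < 2 * L l]. *)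
pose a := Num.max 0 (Num.max A M).
have a0 : 0 <= a by rewrite le_max lexx.
have aA : A <= a by rewrite !le_max lexx orbT.
have aM : M <= a by rewrite !le_max lexx !orbT.
pose Lam (N : nat) := [set l : R | a + N%:R < l].
have Lam_decr N N' : (N <= N')%N -> Lam N' `<=` Lam N.
  by move=> NN l; apply: le_lt_trans; rewrite lerD2l ler_nat.
have F_Lam N : (+oo : set_system R) (Lam N).
  by exists (a + N%:R); split; [rewrite num_real|].
have F_basis U : (+oo : set_system R) U -> exists N, Lam N `<=` U.
  move=> [M' [_ HU]]; exists (Num.truncn `|M'|).+1 => l /= h; apply: HU.
  apply: le_lt_trans h; rewrite (le_trans (ler_norm _))//.
  by rewrite (le_trans (ltW (truncnS_gt _)))// lerDr.
have Lam_pos l : Lam 0%N l -> 0 < l by rewrite /Lam /= addr0; exact: le_lt_trans.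
have [k [C [C0 equi]]] := rescaled_equicontinuous f_cont _ Lam_decr F_Lam F_basis Lam_pos qa.
apply: (quasiasymptotic_extension _ Lam_decr F_Lam Lam_pos qa (k0 := k)).
have La l : Lam k l -> a < l by apply: le_lt_trans; rewrite lerDl.
have Lk l : Lam k l -> 0 < l /\ 0 < L l.
  move=> /La al; split; first exact: le_lt_trans al.
  by apply: Lpos; exact: le_lt_trans al.
have Lam2 l : Lam k l -> Lam k (2 * l).
  move=> Ll; have [l0 _] := Lk l Ll; apply: (lt_trans Ll).
  by rewrite mulr_natl mulr2n ltrDl.
have Lam_gt0 l : Lam k l -> 0 < l by move=> /Lk[].
have gauge_ge0 l : Lam k l -> 0 <= @gauge R n alpha L l.
  by move=> /Lk[l0 Ll]; apply/ltW/gauge_gt0.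
apply: (@uniform_bound_upward _ _ _ _ _ f_cont (Lam k) k C (p + n).+1 Lam_gt0 C0 equi
  gauge_ge0 _ Lam2).
move=> l Ll /Lk[_ L2]; have [l0 L0] := Lk l Ll; apply: gauge_doubling => //.
have := HM l (le_lt_trans aM (La l Ll)); rewrite ltr_norml => /andP[h _].
by rewrite -ler_pdivrMr//; lra.
Unshelve. all: by end_near. Qed.
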